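(* Let $(\mathcal{A},\Omega,\Sigma,\mathrm{L}(\mathcal{F}),\mathrm{R}(\mathcal{C}),\mathcal{X})$ be a pre-partial triangulated category. Then $\big((\mathcal{C}\cap\mathcal{F})/\mathcal{X},\ G^{\mathcal{X}},\ H_{\mathcal{X}},\ \Delta^{\mathcal{X}}(\mathcal{C}\cap\mathcal{F}),\ \nabla_{\mathcal{X}}(\mathcal{C}\cap\mathcal{F})\big)$ is a pre-triangulated category.
   Context: **Conventions.** Subcategories of additive categories are full and closed under isomorphisms; functors between additive categories are additive. If $\mathcal{X}\subseteq\mathcal{C}$ are additive (sub)categories, the stable category $\mathcal{C}/\mathcal{X}$ has the objects of $\mathcal{C}$ and $\mathrm{Hom}_{\mathcal{C}/\mathcal{X}}(A,B)=\mathrm{Hom}_{\mathcal{C}}(A,B)/\mathcal{X}(A,B)$, where $\mathcal{X}(A,B)$ is the subgroup of morphisms factoring through an object of $\mathcal{X}$; $\underline{f}$ is the class of $f$. In an additive category $\mathcal{A}$ with additive subcategory $\mathcal{X}$: $f:A\to B$ is an $\mathcal{X}$-monic if $\mathrm{Hom}(B,X)\to\mathrm{Hom}(A,X)$ is surjective for all $X\in\mathcal{X}$, and an $\mathcal{X}$-preenvelope if moreover $B\in\mathcal{X}$; dually, $\mathcal{X}$-epic and $\mathcal{X}$-precover. $g:B\to C$ is a weak cokernel of $f:A\to B$ if $\mathrm{Hom}(C,M)\to\mathrm{Hom}(B,M)\to\mathrm{Hom}(A,M)$ is exact for all $M\in\mathcal{A}$; weak kernels are dual. **Right and left triangulated categories.**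 Given an endofunctor $\Sigma$, a right $\Sigma$-sequence is $A\to B\to C\to\Sigma(A)$; morphisms of such are commutative ladders $(\alpha,\beta,\gamma,\Sigma(\alpha))$. $(\mathcal{T},\Sigma,\Delta)$, with $\mathcal{T}$ additive, $\Sigma$ an additive endofunctor and $\Delta$ a class of right $\Sigma$-sequences (right triangles) closed under isomorphisms, is right triangulated if: (RT1) every $f:A\to B$ occurs in some $A\xrightarrow{f}B\to C\to\Sigma(A)$ in $\Delta$, and $0\to A\xrightarrow{1}A\to0$ is in $\Delta$ for all $A$; (RT2) if $A\xrightarrow{f}B\xrightarrow{g}C\xrightarrow{h}\Sigma(A)$ is in $\Delta$, so is $B\xrightarrow{g}C\xrightarrow{h}\Sigma(A)\xrightarrow{-\Sigma(f)}\Sigma(B)$; (RT3) given two right triangles with first maps $f:A\to B$, $f':A'\to B'$ and $\alpha,\beta$ with $\beta f=f'\alpha$, there is $\gamma$ making $(\alpha,\beta,\gamma,\Sigma(\alpha))$ a morphism; (RT4) for right triangles $A\xrightarrow{f}B\xrightarrow{l}C'\xrightarrow{m}\Sigma(A)$, $B\xrightarrow{g}C\xrightarrow{h}A'\xrightarrow{j}\Sigma(B)$, $A\xrightarrow{gf}C\xrightarrow{u}B'\xrightarrow{v}\Sigma(A)$ there are $r:C'\to B'$, $s:B'\to A'$ with $rl=ug$, $vr=m$, $su=h$, $js=\Sigma(f)v$ and $C'\xrightarrow{r}B'\xrightarrow{s}A'\xrightarrow{\Sigma(l)j}\Sigma(C')$ in $\Delta$. $(\mathcal{T},\Phi,\nabla)$,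 with $\nabla$ a class of left $\Phi$-sequences $\Phi(C)\to A\to B\to C$, is left triangulated if the opposite category with $\Phi^{op}$ and $\nabla^{op}$ is right triangulated. **Pre-triangulated category.** $(\mathcal{T},\Psi,\Phi,\Delta,\nabla)$ where $(\mathcal{T},\Psi,\Delta)$ is right triangulated, $(\mathcal{T},\Phi,\nabla)$ is left triangulated and: (a) $\Psi$ is left adjoint to $\Phi$, with unit $\eta$ and counit $\varepsilon$; for every right triangle $A\xrightarrow{f}B\xrightarrow{g}C\xrightarrow{h}\Psi(A)$ in $\Delta$ and left triangle $\Phi(C')\xrightarrow{f'}A'\xrightarrow{g'}B'\xrightarrow{h'}C'$ in $\nabla$: (b) if $\alpha:A\to\Phi(C')$, $\beta:B\to A'$ satisfy $\beta f=f'\alpha$, there is $\gamma:C\to B'$ with $\gamma g=g'\beta$ and $h'\gamma=\varepsilon_{C'}\Psi(\alpha)h$; (c) if $\beta:C\to B'$, $\alpha:\Psi(A)\to C'$ satisfy $h'\beta=\alpha h$, there is $\gamma:B\to A'$ with $g'\gamma=\beta g$ and $\gamma f=f'\Phi(\alpha)\eta_A$. **Partial right/left triangulated categories.** Let $\Sigma:\mathcal{A}\to\mathcal{A}$ be an additive endofunctor and $\mathcal{X}\subseteq\mathcal{C}$ additive subcategories of $\mathcal{A}$. A right $\mathcal{C}$-sequence is a right $\Sigma$-sequence $A\xrightarrow{f}B\xrightarrow{g}C\xrightarrow{h}\Sigma(A)$ with $C\in\mathcal{C}$, $g$ a weak cokernel of $f$, $h$ a weak cokernel of $g$. $(\mathcal{A},\Sigma,\mathrm{R}(\mathcal{C}),\mathcal{X})$,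 with $\mathrm{R}(\mathcal{C})$ a class of right $\mathcal{C}$-sequences (right $\mathcal{C}$-triangles) closed under isomorphisms and finite direct sums, is partial right triangulated if: (PRT1)(i) for each $A\in\mathcal{C}$ there is a right $\mathcal{C}$-triangle $A\xrightarrow{i}X\to U\to\Sigma(A)$ with $i$ an $\mathcal{X}$-preenvelope; (ii) for each $f:A\to B$ in $\mathcal{C}$, $A\xrightarrow{\binom{1}{f}}A\oplus B\xrightarrow{(f,-1)}B\xrightarrow{0}\Sigma(A)$ is in $\mathrm{R}(\mathcal{C})$; (iii) if $A\xrightarrow{i}X\to U\to\Sigma(A)$ is in $\mathrm{R}(\mathcal{C})$ with $i$ an $\mathcal{X}$-preenvelope in $\mathcal{C}$, then for any $f:A\to B$ in $\mathcal{C}$ there is a right $\mathcal{C}$-triangle $A\xrightarrow{\binom{i}{f}}X\oplus B\to N\to\Sigma(A)$; (PRT2) for any morphism $(\alpha,\beta,\gamma,\Sigma(\alpha))$ of right $\mathcal{C}$-triangles from $A\xrightarrow{f}B\to C\to\Sigma(A)$ to $A'\to X\xrightarrow{s}U\to\Sigma(A')$ with $X\in\mathcal{X}$, if $\alpha$ factors through $f$ then $\gamma$ factors through $s$; (PRT3) as (RT3) for rows in $\mathrm{R}(\mathcal{C})$; (PRT4) as (RT4) for three right $\mathcal{C}$-triangles as there with $f,g$ being $\mathcal{X}$-monics in $\mathcal{C}$, the conclusion being that the last sequence is in $\mathrm{R}(\mathcal{C})$ and $r$ is an $\mathcal{X}$-monic. Dually, $(\mathcal{A},\Omega,\mathrm{L}(\mathcal{F}),\mathcal{X})$,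 with $\mathcal{X}\subseteq\mathcal{F}$ and $\mathrm{L}(\mathcal{F})$ a class of left $\mathcal{F}$-sequences (left $\mathcal{F}$-triangles) $\Omega(B)\xrightarrow{u}K\xrightarrow{v}A\xrightarrow{f}B$ ($K\in\mathcal{F}$, $v$ a weak kernel of $f$, $u$ a weak kernel of $v$), is partial left triangulated if the opposite data are partial right triangulated. **Induced structures.** For a partial right triangulated category fix for each $A\in\mathcal{C}$ a right $\mathcal{C}$-triangle $A\xrightarrow{i^A}X^A\xrightarrow{p^A}U^A\xrightarrow{q^A}\Sigma(A)$ with $i^A$ an $\mathcal{X}$-preenvelope. $\Sigma^{\mathcal{X}}:\mathcal{C}/\mathcal{X}\to\mathcal{C}/\mathcal{X}$ is the (well-defined) functor $A\mapsto U^A$, $\underline{f}\mapsto\underline{\kappa^f}$ for $f:A\to B$, where $\sigma^f i^A=i^Bf$, $\kappa^fp^A=p^B\sigma^f$, $q^B\kappa^f=\Sigma(f)q^A$. $\Delta^{\mathcal{X}}$ is the class of right $\Sigma^{\mathcal{X}}$-sequences in $\mathcal{C}/\mathcal{X}$ isomorphic to $A\xrightarrow{\underline f}B\xrightarrow{\underline g}C\xrightarrow{\underline{\xi}}\Sigma^{\mathcal{X}}(A)$, where $A\xrightarrow{f}B\xrightarrow{g}C\xrightarrow{h}\Sigma(A)$ is a right $\mathcal{C}$-triangle with $f$ an $\mathcal{X}$-monic in $\mathcal{C}$ and $\xi:C\to U^A$ satisfies $\delta f=i^A$, $\xi g=p^A\delta$, $q^A\xi=h$ for some $\delta:B\to X^A$.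 Dually fix left $\mathcal{F}$-triangles $\Omega(A)\xrightarrow{\nu_A}U_A\xrightarrow{\iota_A}X_A\xrightarrow{\pi_A}A$ with $\pi_A$ an $\mathcal{X}$-precover for $A\in\mathcal{F}$, giving $\Omega_{\mathcal{X}}:\mathcal{F}/\mathcal{X}\to\mathcal{F}/\mathcal{X}$, $A\mapsto U_A$, and $\nabla_{\mathcal{X}}$, the class of left $\Omega_{\mathcal{X}}$-sequences isomorphic to $\Omega_{\mathcal{X}}(B)\xrightarrow{\underline\zeta}K\xrightarrow{\underline v}A\xrightarrow{\underline f}B$ for left $\mathcal{F}$-triangles $\Omega(B)\xrightarrow{u}K\xrightarrow{v}A\xrightarrow{f}B$ with $f$ an $\mathcal{X}$-epic in $\mathcal{F}$, where $f\delta=\pi_B$, $v\zeta=\delta\iota_B$, $\zeta\nu_B=u$ for some $\delta:X_B\to A$. **Stabilizing subcategories.** Let $\mathcal{X}\subseteq\mathcal{G}\subseteq\mathcal{C}$ be additive. $\mathcal{G}$ is special preenveloping in $\mathcal{C}$ if each $A\in\mathcal{C}$ has a (fixed) right $\mathcal{C}$-triangle $A\xrightarrow{j^A}R(A)\to W^A\to\Sigma(A)$ with $j^A$ a $\mathcal{G}$-preenvelope and $\mathrm{Hom}_{\mathcal{C}/\mathcal{X}}(W^A,\mathcal{G})=0$. For $f:A\to B$ in $\mathcal{C}$ choose $\hat f:R(A)\to R(B)$ with $\hat fj^A=j^Bf$; $\underline f\mapsto R(\underline f)=\underline{\hat f}$ defines a functor $R:\mathcal{C}/\mathcal{X}\to\mathcal{G}/\mathcal{X}$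 left adjoint to the inclusion $E^{\mathcal{C}}$; for $A\in\mathcal{G}$, $R(A)$ is identified with $A$. $\mathcal{G}$ is stabilizing in $(\mathcal{A},\Sigma,\mathrm{R}(\mathcal{C}),\mathcal{X})$ if it is special preenveloping in $\mathcal{C}$ and for each $f:A\to B$ in $\mathcal{C}$ and all $A\xrightarrow{\underline f}B\to C\to\Sigma^{\mathcal{X}}(A)$ and $R(A)\xrightarrow{\underline{\hat f}}R(B)\to D\to\Sigma^{\mathcal{X}}(R(A))$ in $\Delta^{\mathcal{X}}$ there is $\underline t:C\to D$ making $(\underline{j}^A,\underline{j}^B,\underline t,\Sigma^{\mathcal{X}}(\underline{j}^A))$ a morphism of sequences with $R(\underline t)$ an isomorphism. Dually, $\mathcal{G}$ with $\mathcal{X}\subseteq\mathcal{G}\subseteq\mathcal{F}$ is special precovering in $\mathcal{F}$ if each $A\in\mathcal{F}$ has a (fixed) left $\mathcal{F}$-triangle $\Omega(A)\to W_A\to Q(A)\xrightarrow{r_A}A$ with $r_A$ a $\mathcal{G}$-precover and $\mathrm{Hom}_{\mathcal{F}/\mathcal{X}}(\mathcal{G},W_A)=0$; then $Q(\underline f)=\underline{\check f}$ with $r_B\check f=fr_A$ is a right adjoint of the inclusion $E_{\mathcal{F}}:\mathcal{G}/\mathcal{X}\to\mathcal{F}/\mathcal{X}$ (with $Q(A)$ identified with $A$ for $A\in\mathcal{G}$), and $\mathcal{G}$ is stabilizing in $(\mathcal{A},\Omega,\mathrm{L}(\mathcal{F}),\mathcal{X})$ if moreover for all $\Omega_{\mathcal{X}}(Q(B))\to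 K\to Q(A)\xrightarrow{\underline{\check f}}Q(B)$ and $\Omega_{\mathcal{X}}(B)\to L\to A\xrightarrow{\underline f}B$ in $\nabla_{\mathcal{X}}$ there is $\underline s:K\to L$ making $(\Omega_{\mathcal{X}}(\underline r_B),\underline s,\underline r_A,\underline r_B)$ a morphism with $Q(\underline s)$ an isomorphism. **The structures in the claim.** With $\mathcal{G}=\mathcal{C}\cap\mathcal{F}$: $G^{\mathcal{X}}=R\circ\Sigma^{\mathcal{X}}\circ E^{\mathcal{C}}$; $\Delta^{\mathcal{X}}(\mathcal{G})$ is the class of right $G^{\mathcal{X}}$-sequences in $\mathcal{G}/\mathcal{X}$ isomorphic to $A\xrightarrow{\underline f}B\xrightarrow{R(\underline g)}R(C)\xrightarrow{R(\underline h)}G^{\mathcal{X}}(A)$ with $A,B\in\mathcal{G}$ and $A\xrightarrow{\underline f}B\xrightarrow{\underline g}C\xrightarrow{\underline h}\Sigma^{\mathcal{X}}(A)$ in $\Delta^{\mathcal{X}}$. Dually $H_{\mathcal{X}}=Q\circ\Omega_{\mathcal{X}}\circ E_{\mathcal{F}}$, and $\nabla_{\mathcal{X}}(\mathcal{G})$ is the class of left $H_{\mathcal{X}}$-sequences isomorphic to $H_{\mathcal{X}}(B)\xrightarrow{Q(\underline v)}Q(K)\xrightarrow{Q(\underline u)}A\xrightarrow{\underline f}B$ with $A,B\in\mathcal{G}$ and $\Omega_{\mathcal{X}}(B)\xrightarrow{\underline v}K\xrightarrow{\underline u}A\xrightarrow{\underline f}B$ in $\nabla_{\mathcal{X}}$.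 **Pre-partial triangulated category.** $(\mathcal{A},\Omega,\Sigma,\mathrm{L}(\mathcal{F}),\mathrm{R}(\mathcal{C}),\mathcal{X})$ where $(\mathcal{A},\Sigma,\mathrm{R}(\mathcal{C}),\mathcal{X})$ is partial right triangulated, $(\mathcal{A},\Omega,\mathrm{L}(\mathcal{F}),\mathcal{X})$ is partial left triangulated, and: (a) $\Omega$ is left adjoint to $\Sigma$, with adjunction isomorphism $\psi_{C,A}:\mathrm{Hom}(\Omega(C),A)\to\mathrm{Hom}(C,\Sigma(A))$. (b) $\mathcal{C}\cap\mathcal{F}$ is stabilizing in both $(\mathcal{A},\Sigma,\mathrm{R}(\mathcal{C}),\mathcal{X})$ and $(\mathcal{A},\Omega,\mathrm{L}(\mathcal{F}),\mathcal{X})$. (c) Given a right $\mathcal{C}$-triangle $A\xrightarrow{f}B\xrightarrow{g}C\xrightarrow{h}\Sigma(A)$ with $f$ an $\mathcal{X}$-monic, a left $\mathcal{F}$-triangle $\Omega(N)\xrightarrow{u}L\xrightarrow{v}M\xrightarrow{w}N$ with $w$ an $\mathcal{X}$-epic, and $\beta:B\to M$: (i) if $\gamma:C\to N$ satisfies $\gamma g=w\beta$, there is $\alpha:A\to L$ with $v\alpha=\beta f$ and $u\Omega(\gamma)=-\alpha\psi^{-1}_{C,A}(h)$; (ii) if $\alpha:A\to L$ satisfies $v\alpha=\beta f$, there is $\gamma:C\to N$ with $\gamma g=w\beta$ and $\Sigma(\alpha)h=-\psi_{N,L}(u)\gamma$. (d) Let $A\in\mathcal{C}\cap\mathcal{F}$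 with its fixed right $\mathcal{C}$-triangle $A\xrightarrow{i^A}X^A\xrightarrow{p^A}U^A\xrightarrow{q^A}\Sigma(A)$, let $\Omega(N)\xrightarrow{u}L\xrightarrow{v}M\xrightarrow{w}N$ be in $\mathrm{L}(\mathcal{F})$ with $w$ an $\mathcal{X}$-epic, and let $\alpha:A\to L$, $\beta:X^A\to M$, $\gamma:U^A\to N$ satisfy $v\alpha=\beta i^A$, $w\beta=\gamma p^A$, $u\Omega(\gamma)=-\alpha\psi^{-1}_{U^A,A}(q^A)$. If $\gamma$ factors through $w$, then $\alpha$ factors through $i^A$. (e) Let $D\in\mathcal{C}\cap\mathcal{F}$ with its fixed left $\mathcal{F}$-triangle $\Omega(D)\xrightarrow{\nu_D}U_D\xrightarrow{\iota_D}X_D\xrightarrow{\pi_D}D$, let $A\xrightarrow{f}B\xrightarrow{g}C\xrightarrow{h}\Sigma(A)$ be in $\mathrm{R}(\mathcal{C})$ with $f$ an $\mathcal{X}$-monic, and let $\alpha:A\to U_D$, $\beta:B\to X_D$, $\gamma:C\to D$ satisfy $\iota_D\alpha=\beta f$, $\pi_D\beta=\gamma g$, $\Sigma(\alpha)h=-\psi_{D,U_D}(\nu_D)\gamma$. If $\alpha$ factors through $f$, then $\gamma$ factors through $\pi_D$. *)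

(* Defs.v *)
From HB Require Import structures.
From mathcomp Require Import all_boot all_order all_algebra.
From mathcomp Require Import generic_quotient ring_quotient boolp.

Set Implicit Arguments.
Unset Strict Implicit.
Unset Printing Implicit Defensive.

Import GRing.Theory.
Local Open Scope ring_scope.
Local Open Scope quotient_scope.

(* Zero object and binary biproducts are chosen; an object is zero exactly when
   its identity is the zero morphism. *)
Record addcat := AddCat {
  Ob :> Type;
  Hom : Ob -> Ob -> zmodType;
  idm : forall a, Hom a a;
  comp : forall a b c, Hom b c -> Hom a b -> Hom a c;
  compA : forall a b c d (h : Hom c d) (g : Hom b c) (f : Hom a b),
    comp h (comp g f) = comp (comp h g) f;
  comp1m : forall a b (f : Hom a b), comp (idm b) f = f;
  compm1 : forall a b (f : Hom a b), comp f (idm a) = f;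
  compDl : forall a b c (g g' : Hom b c) (f : Hom a b),
    comp (g + g') f = comp g f + comp g' f;
  compDr : forall a b c (g : Hom b c) (f f' : Hom a b),
    comp g (f + f') = comp g f + comp g f';
  zob : Ob;
  zobP : idm zob = 0;
  bip : Ob -> Ob -> Ob;
  in1 : forall a b, Hom a (bip a b);
  in2 : forall a b, Hom b (bip a b);
  pr1 : forall a b, Hom (bip a b) a;
  pr2 : forall a b, Hom (bip a b) b;
  pr1in1 : forall a b, comp (pr1 a b) (in1 a b) = idm a;
  pr2in2 : forall a b, comp (pr2 a b) (in2 a b) = idm b;
  pr1in2 : forall a b, comp (pr1 a b) (in2 a b) = 0;
  pr2in1 : forall a b, comp (pr2 a b) (in1 a b) = 0;
  bipP : forall a b,
    comp (in1 a b) (pr1 a b) + comp (in2 a b) (pr2 a b) = idm (bip a b)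
}.
Arguments idm {_} _.
Arguments in1 {_} _ _.
Arguments in2 {_} _ _.
Arguments pr1 {_} _ _.
Arguments pr2 {_} _ _.

Notation "g ∘ f" := (comp g f) (at level 40, left associativity) : ring_scope.

Section AddCatTheory.
Variable A : addcat.

Lemma comp0m (a b c : A) (f : Hom a b) : (0 : Hom b c) ∘ f = 0.
Proof. by apply: (addrI (0 ∘ f)); rewrite -compDl !addr0. Qed.

Lemma compm0 (a b c : A) (g : Hom b c) : g ∘ (0 : Hom a b) = 0.
Proof. by apply: (addrI (g ∘ 0)); rewrite -compDr !addr0. Qed.

Lemma compNm (a b c : A) (g : Hom b c) (f : Hom a b) : (- g) ∘ f = - (g ∘ f).
Proof. by apply: (addrI (g ∘ f)); rewrite -compDl !subrr comp0m. Qed.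

Lemma compmN (a b c : A) (g : Hom b c) (f : Hom a b) : g ∘ (- f) = - (g ∘ f).
Proof. by apply: (addrI (g ∘ f)); rewrite -compDr !subrr compm0. Qed.

Lemma compBl (a b c : A) (g g' : Hom b c) (f : Hom a b) :
  (g - g') ∘ f = g ∘ f - g' ∘ f.
Proof. by rewrite compDl compNm. Qed.

Lemma compBr (a b c : A) (g : Hom b c) (f f' : Hom a b) :
  g ∘ (f - f') = g ∘ f - g ∘ f'.
Proof. by rewrite compDr compmN. Qed.

Definition isiso (a b : A) (f : Hom a b) : Prop :=
  exists g : Hom b a, g ∘ f = idm a /\ f ∘ g = idm b.

End AddCatTheory.

Definition op (A : addcat) : addcat :=
  @AddCat (Ob A) (fun a b => Hom b a) (fun a => idm a)
    (fun a b c g f => f ∘ g)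
    (fun a b c d h g f => esym (compA f g h))
    (fun a b f => compm1 f)
    (fun a b f => comp1m f)
    (fun a b c g g' f => compDr f g g')
    (fun a b c g f f' => compDl f f' g)
    (zob A) (zobP A) (@bip A)
    (@pr1 A) (@pr2 A) (@in1 A) (@in2 A)
    (@pr1in1 A) (@pr2in2 A) (@pr2in1 A) (@pr1in2 A) (@bipP A).

Record addfun (A B : addcat) := AddFun {
  fob :> A -> B;
  fmap : forall a b : A, Hom a b -> Hom (fob a) (fob b);
  fmap1 : forall a : A, fmap (idm a) = idm (fob a);
  fmapM : forall (a b c : A) (g : Hom b c) (f : Hom a b),
    fmap (g ∘ f) = fmap g ∘ fmap f;
  fmapD : forall (a b : A) (f g : Hom a b), fmap (f + g) = fmap f + fmap g
}.
Arguments fmap {_ _} _ {_ _} _.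

Definition opF (A B : addcat) (F : addfun A B) : addfun (op A) (op B) :=
  @AddFun (op A) (op B) (fob F) (fun a b f => fmap F (f : @Hom A b a))
    (fun a => fmap1 F a) (fun a b c g f => fmapM F f g)
    (fun a b f g => fmapD F f g).

Definition compF (A B C : addcat) (G : addfun B C) (F : addfun A B) :
  addfun A C.
Proof.
refine (@AddFun A C (fun a => G (F a)) (fun a b f => fmap G (fmap F f)) _ _ _).
- by move=> a; rewrite !fmap1.
- by move=> a b c g f; rewrite !fmapM.
- by move=> a b f g; rewrite !fmapD.
Defined.

(* L is left adjoint to R. *)
Record adjunction (A B : addcat) (L : addfun A B) (R : addfun B A) := Adj {
  unit_ : forall a : A, Hom a (R (L a));
  counit : forall b : B, Hom (L (R b)) b;
  unit_nat : forall (a a' : A) (f : Hom a a'),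
    unit_ a' ∘ f = fmap R (fmap L f) ∘ unit_ a;
  counit_nat : forall (b b' : B) (f : Hom b b'),
    counit b' ∘ fmap L (fmap R f) = f ∘ counit b;
  adj_tri1 : forall a : A, counit (L a) ∘ fmap L (unit_ a) = idm (L a);
  adj_tri2 : forall b : B, fmap R (counit b) ∘ unit_ (R b) = idm (R b)
}.
Arguments unit_ {_ _ _ _} _ _.
Arguments counit {_ _ _ _} _ _.

Definition adj_psi (A B : addcat) (L : addfun A B) (R : addfun B A)
    (adj : adjunction L R) (a : A) (b : B) (f : Hom (L a) b) : Hom a (R b) :=
  fmap R f ∘ unit_ adj a.

Definition adj_psiV (A B : addcat) (L : addfun A B) (R : addfun B A)
    (adj : adjunction L R) (a : A) (b : B) (g : Hom a (R b)) : Hom (L a) b :=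
  counit adj b ∘ fmap L g.

Record addsub (A : addcat) := AddSub {
  insub :> A -> Prop;
  insub_iso : forall (a b : A) (f : Hom a b), isiso f -> insub a -> insub b;
  insub0 : insub (zob A);
  insub_bip : forall a b : A, insub a -> insub b -> insub (bip a b)
}.

Definition subcat_le (A : addcat) (X Y : addsub A) : Prop :=
  forall a : A, X a -> Y a.

Definition subcatI (A : addcat) (C F : addsub A) : addsub A.
Proof.
refine (@AddSub A (fun a => C a /\ F a) _ _ _).
- by move=> a b f fi [Ca Fa]; split; apply: insub_iso fi _.
- by split; apply: insub0.
- by move=> a b [Ca Fa] [Cb Fb]; split; apply: insub_bip.
Defined.

Lemma subcatI_l (A : addcat) (C F : addsub A) : subcat_le (subcatI C F) C.
Proof. by move=> a []. Qed.

Lemma subcatI_r (A : addcat) (C F : addsub A) : subcat_le (subcatI C F) F.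
Proof. by move=> a []. Qed.

Definition opsub (A : addcat) (X : addsub A) : addsub (op A).
Proof.
refine (@AddSub (op A) (fun a => X a) _ (insub0 X) (@insub_bip A X)).
move=> a b f [g [gf fg]]; apply: (@insub_iso A X a b g).
by exists f; split.
Defined.

Record objs (A : addcat) (P : addsub A) := InSub {
  oval :> A;
  ovalP : P oval
}.

Definition osub (A : addcat) (P Q : addsub A) (le : subcat_le P Q)
  (a : objs P) : objs Q := InSub (le _ (ovalP a)).

Definition is_monic (A : addcat) (X : addsub A) (a b : A) (f : Hom a b) :=
  forall (x : A) (u : Hom a x), X x -> exists v : Hom b x, v ∘ f = u.

Definition is_preenvelope (A : addcat) (X : addsub A) (a b : A)
  (f : Hom a b) := X b /\ is_monic X f.

Definition is_epic (A : addcat) (X : addsub A) (a b : A) (f : Hom a b) :=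
  forall (x : A) (u : Hom x b), X x -> exists v : Hom x a, f ∘ v = u.

Definition is_precover (A : addcat) (X : addsub A) (a b : A)
  (f : Hom a b) := X a /\ is_epic X f.

Definition is_wcok (A : addcat) (a b c : A) (f : Hom a b) (g : Hom b c) :=
  forall (m : A) (u : Hom b m),
    u ∘ f = 0 <-> exists v : Hom c m, u = v ∘ g.

Definition factors (A : addcat) (X : addsub A) (a b : A) : {pred Hom a b} :=
  fun f => `[< exists (x : A) (u : Hom a x) (v : Hom x b),
                 X x /\ f = v ∘ u >].
Arguments factors {_} _ _ _ _.

Section Factors.
Variables (A : addcat) (X : addsub A).

Lemma factorsP (a b : A) (f : Hom a b) :
  reflect (exists (x : A) (u : Hom a x) (v : Hom x b), X x /\ f = v ∘ u)
          (f \in factors X a b).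
Proof. exact: asboolP. Qed.

Lemma factors_zmod (a b : A) : zmod_closed (factors X a b).
Proof.
split=> [|f g /factorsP[x [u [v [Xx ->]]]] /factorsP[y [u' [v' [Xy ->]]]]].
  by apply/factorsP; exists (zob A), 0, 0; split; [apply: insub0|rewrite compm0].
apply/factorsP; exists (bip x y), (in1 x y ∘ u - in2 x y ∘ u'),
  (v ∘ pr1 x y + v' ∘ pr2 x y); split; first exact: insub_bip.
rewrite compDl -(compA _ (pr1 _ _)) -(compA _ (pr2 _ _)) !compBr.
rewrite !(compA (pr1 _ _)) !(compA (pr2 _ _)).
rewrite pr1in1 pr2in2 pr1in2 pr2in1 !comp1m !comp0m.
by rewrite !compm0 subr0 sub0r.
Qed.

HB.instance Definition _ (a b : A) :=
  GRing.isZmodClosed.Build (Hom a b) (factors X a b) (factors_zmod a b).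

Definition qHom (a b : A) : zmodType := Quotient.quot (factors X a b).

Definition cls (a b : A) (f : Hom a b) : qHom a b := \pi_(Quotient.quot (factors X a b)) f.

Lemma cls_eq (a b : A) (f g : Hom a b) :
  cls f = cls g <-> f - g \in factors X a b.
Proof.
rewrite (Quotient.idealrBE (factors X a b)).
by split=> [/eqP|/eqP].
Qed.

Lemma factors_postcomp (a b c : A) (g : Hom b c) (f : Hom a b) :
  f \in factors X a b -> g ∘ f \in factors X a c.
Proof.
case/factorsP=> x [u [v [Xx ->]]]; apply/factorsP.
by exists x, u, (g ∘ v); split=> //; rewrite compA.
Qed.

Lemma factors_precomp (a b c : A) (g : Hom b c) (f : Hom a b) :
  g \in factors X b c -> g ∘ f \in factors X a c.
Proof.
case/factorsP=> x [u [v [Xx ->]]]; apply/factorsP.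
by exists x, (u ∘ f), v; split=> //; rewrite compA.
Qed.

Definition qcomp (a b c : A) (g : qHom b c) (f : qHom a b) : qHom a c :=
  cls (repr g ∘ repr f).

Lemma clsK (a b : A) (q : qHom a b) : cls (repr q) = q.
Proof. exact: reprK. Qed.

Lemma clsD (a b : A) (f g : Hom a b) : cls (f + g) = cls f + cls g.
Proof. exact: raddfD. Qed.

Lemma cls0 (a b : A) : cls (0 : Hom a b) = 0.
Proof. exact: raddf0. Qed.

Lemma clsM (a b c : A) (g : Hom b c) (f : Hom a b) :
  cls (g ∘ f) = qcomp (cls g) (cls f).
Proof.
have eg := esym (clsK (cls g)); have ef := esym (clsK (cls f)).
apply/cls_eq; set g' := repr _; set f' := repr _.
have -> : g ∘ f - g' ∘ f' = (g - g') ∘ f + g' ∘ (f - f').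
  by rewrite compBl compBr addrA subrK.
apply: rpredD; first by apply: factors_precomp; apply/cls_eq.
by apply: factors_postcomp; apply/cls_eq.
Qed.

End Factors.

(* The stable category P/X: the objects of P, the morphisms of A modulo those
   factoring through an object of X (P is full and contains X in all uses). *)
Definition stable (A : addcat) (P X : addsub A) : addcat.
Proof.
refine (@AddCat (objs P) (fun a b => qHom X a b) (fun a => cls X (idm (oval a)))
  (fun a b c g f => qcomp g f) _ _ _ _ _
  (InSub (insub0 P)) _
  (fun a b => InSub (insub_bip (ovalP a) (ovalP b)))
  (fun a b => cls X (in1 (oval a) (oval b)))
  (fun a b => cls X (in2 (oval a) (oval b)))
  (fun a b => cls X (pr1 (oval a) (oval b)))
  (fun a b => cls X (pr2 (oval a) (oval b))) _ _ _ _ _).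
- move=> a b c d h g f; rewrite -(clsK h) -(clsK g) -(clsK f).
  by rewrite -!clsM compA.
- by move=> a b f; rewrite -(clsK f) -clsM comp1m.
- by move=> a b f; rewrite -(clsK f) -clsM compm1.
- move=> a b c g g' f; rewrite -(clsK f) -(clsK g) -(clsK g').
  by rewrite -clsD -!clsM compDl clsD.
- move=> a b c g f f'; rewrite -(clsK f) -(clsK g) -(clsK f').
  by rewrite -clsD -!clsM compDr clsD.
- by rewrite /= zobP cls0.
- by move=> a b; rewrite -clsM pr1in1.
- by move=> a b; rewrite -clsM pr2in2.
- by move=> a b; rewrite -clsM pr1in2 cls0.
- by move=> a b; rewrite -clsM pr2in1 cls0.
- by move=> a b; rewrite -!clsM -clsD bipP.
Defined.

Definition scls (A : addcat) (P X : addsub A) (a b : objs P)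
    (f : @Hom A a b) : @Hom (stable P X) a b := cls X f.

Lemma sclsM (A : addcat) (P X : addsub A) (a b c : objs P)
    (g : @Hom A b c) (f : @Hom A a b) :
  scls X (g ∘ f) = scls X g ∘ scls X f.
Proof. exact: clsM. Qed.

Lemma sclsD (A : addcat) (P X : addsub A) (a b : objs P) (f g : @Hom A a b) :
  scls X (f + g) = scls X f + scls X g.
Proof. exact: clsD. Qed.

Lemma scls_surj (A : addcat) (P X : addsub A) (a b : objs P)
    (q : @Hom (stable P X) a b) : exists f : @Hom A a b, q = scls X f.
Proof. by exists (repr q); rewrite [RHS]clsK. Qed.

Definition inclF (A : addcat) (P Q X : addsub A) (le : subcat_le P Q) :
    addfun (stable P X) (stable Q X) :=
  @AddFun (stable P X) (stable Q X) (osub le) (fun a b f => f)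
    (fun a => erefl) (fun a b c g f => erefl) (fun a b f g => erefl).

(* A relation between morphisms of P and morphisms of Q that is total and
   compatible with the additive structure and with X induces a functor
   P/X -> Q/X, by sending the class of f to the class of any g related to f. *)
Record indrel (A : addcat) (P Q X : addsub A) (F0 : objs P -> objs Q) := IndRel {
  irel : forall a b : objs P, @Hom A a b -> @Hom A (F0 a) (F0 b) -> Prop;
  irel_total : forall (a b : objs P) (f : @Hom A a b),
    exists g, irel f g;
  irel1 : forall a : objs P, irel (idm (oval a)) (idm (oval (F0 a)));
  irelM : forall (a b c : objs P) (f : @Hom A a b) (g : @Hom A b c) f' g',
    irel f f' -> irel g g' -> irel (g ∘ f) (g' ∘ f');
  irelD : forall (a b : objs P) (f g : @Hom A a b) f' g',
    irel f f' -> irel g g' -> irel (f + g) (f' + g');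
  irelX : forall (a b : objs P) (f : @Hom A a b) f',
    irel f f' -> f \in factors X a b -> f' \in factors X (F0 a) (F0 b)
}.

Section IndF.
Variables (A : addcat) (P Q X : addsub A) (F0 : objs P -> objs Q).
Variable r : indrel X F0.

Lemma irel_cls (a b : objs P) (f g : @Hom A a b) f' g' :
  irel r f f' -> irel r g g' -> scls X f = scls X g -> scls X f' = scls X g'.
Proof.
move=> rf rg /cls_eq fg; apply/cls_eq.
have [k rk] := irel_total r (- g).
have -> : f' - g' = (f' + k) - (g' + k) by rewrite opprD addrACA subrr addr0.
apply: rpredB; first exact: irelX (irelD rf rk) fg.
by apply: irelX (irelD rg rk) _; rewrite subrr rpred0.
Qed.

Definition indmap (a b : objs P) (f : @Hom (stable P X) a b) :
    @Hom (stable Q X) (F0 a) (F0 b) :=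
  scls X (sval (cid (irel_total r (repr f)))).

Lemma indmapE (a b : objs P) (f : @Hom A a b) f' :
  irel r f f' -> indmap (scls X f) = scls X f'.
Proof.
move=> rf; rewrite /indmap; case: cid => g /= rg.
by apply: irel_cls rg rf _; exact: clsK.
Qed.

Definition indF : addfun (stable P X) (stable Q X).
Proof.
refine (@AddFun (stable P X) (stable Q X) F0 indmap _ _ _).
- by move=> a; apply: indmapE; apply: irel1.
- move=> a b c q p; have [g ->] := scls_surj q; have [f ->] := scls_surj p.
  have [f' rf] := irel_total r f; have [g' rg] := irel_total r g.
  by rewrite -sclsM (indmapE (irelM rf rg)) (indmapE rf) (indmapE rg) sclsM.
- move=> a b p q; have [f ->] := scls_surj p; have [g ->] := scls_surj q.
  have [f' rf] := irel_total r f; have [g' rg] := irel_total r g.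
  by rewrite -sclsD (indmapE (irelD rf rg)) (indmapE rf) (indmapE rg) sclsD.
Defined.

End IndF.

Record rseq (T : addcat) (S : addfun T T) := RSeq_ {
  rA : T; rB : T; rC : T;
  rf : Hom rA rB; rg : Hom rB rC; rh : Hom rC (S rA)
}.

Definition RSeq (T : addcat) (S : addfun T T) (a b c : T)
  (f : Hom a b) (g : Hom b c) (h : Hom c (S a)) : rseq S := RSeq_ f g h.

Definition rmor (T : addcat) (S : addfun T T) (s t : rseq S)
    (al : Hom (rA s) (rA t)) (be : Hom (rB s) (rB t))
    (ga : Hom (rC s) (rC t)) : Prop :=
  [/\ be ∘ rf s = rf t ∘ al, ga ∘ rg s = rg t ∘ be &
      fmap S al ∘ rh s = rh t ∘ ga].

Definition riso (T : addcat) (S : addfun T T) (s t : rseq S) : Prop :=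
  exists al be ga, [/\ rmor (s := s) (t := t) al be ga,
    isiso al, isiso be & isiso ga].

Definition rsum (T : addcat) (S : addfun T T) (s t : rseq S) : rseq S :=
  RSeq
    (in1 (rB s) (rB t) ∘ rf s ∘ pr1 (rA s) (rA t)
       + in2 (rB s) (rB t) ∘ rf t ∘ pr2 (rA s) (rA t))
    (in1 (rC s) (rC t) ∘ rg s ∘ pr1 (rB s) (rB t)
       + in2 (rC s) (rC t) ∘ rg t ∘ pr2 (rB s) (rB t))
    (fmap S (in1 (rA s) (rA t)) ∘ rh s ∘ pr1 (rC s) (rC t)
       + fmap S (in2 (rA s) (rA t)) ∘ rh t ∘ pr2 (rC s) (rC t)).

Definition rseq0 (T : addcat) (S : addfun T T) : rseq S :=
  @RSeq T S (zob T) (zob T) (zob T) 0 0 0.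

Record lseq (T : addcat) (O : addfun T T) := LSeq_ {
  lA : T; lB : T; lC : T;
  lf : Hom (O lC) lA; lg : Hom lA lB; lh : Hom lB lC
}.

Definition LSeq (T : addcat) (O : addfun T T) (a b c : T)
  (f : Hom (O c) a) (g : Hom a b) (h : Hom b c) : lseq O := LSeq_ f g h.

Definition lmor (T : addcat) (O : addfun T T) (s t : lseq O)
    (al : Hom (lA s) (lA t)) (be : Hom (lB s) (lB t))
    (ga : Hom (lC s) (lC t)) : Prop :=
  [/\ al ∘ lf s = lf t ∘ fmap O ga, be ∘ lg s = lg t ∘ al &
      ga ∘ lh s = lh t ∘ be].

Definition liso (T : addcat) (O : addfun T T) (s t : lseq O) : Prop :=
  exists al be ga, [/\ lmor (s := s) (t := t) al be ga,
    isiso al, isiso be & isiso ga].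

(* A right sequence in the opposite category, read backwards. *)
Definition lseq_of_op (T : addcat) (O : addfun T T) (s : rseq (opF O)) :
    lseq O :=
  @LSeq T O (rC s) (rB s) (rA s) (rh s) (rg s) (rf s).

Section RightTriangulated.
Variables (T : addcat) (S : addfun T T) (D : rseq S -> Prop).

Definition ladder_completion : Prop :=
  forall (s t : rseq S) (al : Hom (rA s) (rA t)) (be : Hom (rB s) (rB t)),
    D s -> D t -> be ∘ rf s = rf t ∘ al ->
    exists ga, rmor (s := s) (t := t) al be ga.

(* M constrains the two composable morphisms, M' is an extra conclusion on the
   first map of the resulting triangle. *)
Definition octahedron (M : forall a b : T, Hom a b -> Prop)
    (M' : forall a b : T, Hom a b -> Prop) : Prop :=
  forall (a b c c' a' b' : T) (f : Hom a b) (g : Hom b c)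
    (l : Hom b c') (m : Hom c' (S a)) (h : Hom c a') (j : Hom a' (S b))
    (u : Hom c b') (v : Hom b' (S a)),
    M _ _ f -> M _ _ g ->
    D (RSeq f l m) -> D (RSeq g h j) -> D (RSeq (g ∘ f) u v) ->
    exists (r : Hom c' b') (s : Hom b' a'),
      [/\ r ∘ l = u ∘ g, v ∘ r = m, s ∘ u = h & j ∘ s = fmap S f ∘ v] /\
      (D (RSeq r s (fmap S l ∘ j)) /\ M' _ _ r).

Record right_triangulated : Prop := {
  rt_iso : forall s t : rseq S, riso s t -> D s -> D t;
  rt1_ex : forall (a b : T) (f : Hom a b),
    exists (c : T) (g : Hom b c) (h : Hom c (S a)), D (RSeq f g h);
  rt1_id : forall a : T, D (@RSeq T S (zob T) a a 0 (idm a) 0);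
  rt2 : forall (a b c : T) (f : Hom a b) (g : Hom b c) (h : Hom c (S a)),
    D (RSeq f g h) -> D (RSeq g h (- fmap S f));
  rt3 : ladder_completion;
  rt4 : octahedron (fun _ _ _ => True) (fun _ _ _ => True)
}.

End RightTriangulated.

Definition left_triangulated (T : addcat) (O : addfun T T)
    (N : lseq O -> Prop) : Prop :=
  @right_triangulated (op T) (opF O) (fun s => N (lseq_of_op s)).

Record pre_triangulated (T : addcat) (Psi Phi : addfun T T)
    (D : rseq Psi -> Prop) (N : lseq Phi -> Prop) : Prop := {
  pt_right : right_triangulated D;
  pt_left : left_triangulated N;
  pt_glue : exists adj : adjunction Psi Phi,
    forall (a b c : T) (f : Hom a b) (g : Hom b c) (h : Hom c (Psi a))
      (a' b' c' : T) (f' : Hom (Phi c') a') (g' : Hom a' b') (h' : Hom b' c'),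
      D (RSeq f g h) -> N (LSeq f' g' h') ->
      (forall (al : Hom a (Phi c')) (be : Hom b a'),
        be ∘ f = f' ∘ al ->
        exists ga : Hom c b',
          ga ∘ g = g' ∘ be /\ h' ∘ ga = counit adj c' ∘ fmap Psi al ∘ h) /\
      (forall (be : Hom c b') (al : Hom (Psi a) c'),
        h' ∘ be = al ∘ h ->
        exists ga : Hom b a',
          g' ∘ ga = be ∘ g /\ ga ∘ f = f' ∘ fmap Phi al ∘ unit_ adj a)
}.

Section PartialRight.
Variables (A : addcat) (S : addfun A A) (C X : addsub A) (RC : rseq S -> Prop).

Definition right_Cseq (s : rseq S) : Prop :=
  [/\ C (rC s), is_wcok (rf s) (rg s) & is_wcok (rg s) (rh s)].

Record partial_right_triangulated : Prop := {
  prt_sub : subcat_le X C;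
  prt_seq : forall s, RC s -> right_Cseq s;
  prt_iso : forall s t, riso s t -> RC s -> RC t;
  (* finite direct sums: the empty one and the binary ones *)
  prt_zero : RC (rseq0 S);
  prt_sum : forall s t, RC s -> RC t -> RC (rsum s t);
  prt1_env : forall a : A, C a ->
    exists (x u : A) (i : Hom a x) (p : Hom x u) (q : Hom u (S a)),
      RC (RSeq i p q) /\ is_preenvelope X i;
  prt1_graph : forall (a b : A) (f : Hom a b), C a -> C b ->
    RC (@RSeq A S a (bip a b) b
          (in1 a b + in2 a b ∘ f) (f ∘ pr1 a b - pr2 a b) 0);
  prt1_push : forall (a x u : A) (i : Hom a x) (p : Hom x u) (q : Hom u (S a)),
    RC (RSeq i p q) -> C a -> is_preenvelope X i ->
    forall (b : A) (f : Hom a b), C b ->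
    exists (n : A) (g : Hom (bip x b) n) (h : Hom n (S a)),
      RC (RSeq (in1 x b ∘ i + in2 x b ∘ f) g h);
  prt2 : forall (s t : rseq S) (al : Hom (rA s) (rA t))
      (be : Hom (rB s) (rB t)) (ga : Hom (rC s) (rC t)),
    RC s -> RC t -> X (rB t) -> rmor (s := s) (t := t) al be ga ->
    (exists k : Hom (rB s) (rA t), al = k ∘ rf s) ->
    exists l : Hom (rC s) (rB t), ga = rg t ∘ l;
  prt3 : ladder_completion RC;
  prt4 : octahedron RC
    (fun a b (f : Hom a b) => [/\ C a, C b & is_monic X f])
    (fun a b (f : Hom a b) => is_monic X f)
}.

End PartialRight.

Definition partial_left_triangulated (A : addcat) (O : addfun A A)
    (F X : addsub A) (LF : lseq O -> Prop) : Prop :=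
  @partial_right_triangulated (op A) (opF O) (opsub F) (opsub X)
    (fun s => LF (lseq_of_op s)).

Record rfixed (A : addcat) (S : addfun A A) (C X : addsub A)
    (RC : rseq S -> Prop) := RFixed {
  rX : objs C -> A;
  rU : objs C -> A;
  ri : forall a : objs C, @Hom A a (rX a);
  rp : forall a : objs C, Hom (rX a) (rU a);
  rq : forall a : objs C, Hom (rU a) (S a);
  rfixed_tri : forall a : objs C, RC (RSeq (ri a) (rp a) (rq a));
  rfixed_env : forall a : objs C, is_preenvelope X (ri a)
}.

Section RightInduced.
Variables (A : addcat) (S : addfun A A) (C X : addsub A) (RC : rseq S -> Prop).
Hypothesis prt : partial_right_triangulated C X RC.
Variable fx : rfixed C X RC.

Lemma rU_in (a : objs C) : C (rU fx a).
Proof. by have [] := prt_seq prt (rfixed_tri fx a). Qed.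

Definition SigmaX_ob (a : objs C) : objs C := InSub (rU_in a).

Definition kappa_rel (a b : objs C) (f : @Hom A a b)
    (k : @Hom A (SigmaX_ob a) (SigmaX_ob b)) : Prop :=
  exists sg : Hom (rX fx a) (rX fx b),
    [/\ sg ∘ ri fx a = ri fx b ∘ f, k ∘ rp fx a = rp fx b ∘ sg &
        rq fx b ∘ k = fmap S f ∘ rq fx a].

Definition SigmaX_rel : indrel X SigmaX_ob.
Proof.
refine (@IndRel _ _ _ _ _ kappa_rel _ _ _ _ _).
- move=> a b f; have [_ mi] := rfixed_env fx a.
  have [Xb _] := rfixed_env fx b.
  have [sg sgE] := mi _ (ri fx b ∘ f) Xb.
  have [k [_ k2 k3]] := prt3 prt (rfixed_tri fx a) (rfixed_tri fx b) sgE.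
  by exists k, sg; split=> //; exact: esym k3.
- by move=> a; exists (idm _); rewrite fmap1 !comp1m !compm1.
- move=> a b c f g f' g' [s [s1 s2 s3]] [t [t1 t2 t3]]; exists (t ∘ s).
  split.
  + by rewrite -compA s1 !compA t1.
  + by rewrite -compA s2 !compA t2.
  + by rewrite compA t3 -compA s3 fmapM compA.
- move=> a b f g f' g' [s [s1 s2 s3]] [t [t1 t2 t3]]; exists (s + t).
  by rewrite fmapD !compDl !compDr s1 s2 s3 t1 t2 t3.
- move=> a b f f' [s [s1 s2 s3]] /factorsP[x [u [v [Xx fE]]]].
  have [_ mi] := rfixed_env fx a; have [Xb _] := rfixed_env fx b.
  have [w wE] := mi _ u Xx.
  have [|l lE] := prt2 prt (rfixed_tri fx a) (rfixed_tri fx b) Xb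
    (And3 s1 s2 (esym s3)).
    by exists (v ∘ w); rewrite -compA wE.
  by apply/factorsP; exists (rX fx b), l, (rp fx b).
Defined.

Definition SigmaX : addfun (stable C X) (stable C X) := indF SigmaX_rel.

Definition DeltaX (s : rseq SigmaX) : Prop :=
  exists (a b c : objs C) (f : @Hom A a b) (g : @Hom A b c)
    (h : Hom (oval c) (S a)) (de : Hom (oval b) (rX fx a))
    (xi : @Hom A c (SigmaX_ob a)),
    [/\ RC (RSeq f g h) /\ is_monic X f,
        de ∘ f = ri fx a, xi ∘ g = rp fx a ∘ de, rq fx a ∘ xi = h &
        riso (@RSeq (stable C X) SigmaX a b c
                (scls X f) (scls X g) (scls X xi)) s].

End RightInduced.

Record lfixed (A : addcat) (O : addfun A A) (F X : addsub A)
    (LF : lseq O -> Prop) := LFixed {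
  lX : objs F -> A;
  lU : objs F -> A;
  lnu : forall a : objs F, Hom (O a) (lU a);
  liota : forall a : objs F, Hom (lU a) (lX a);
  lpi : forall a : objs F, @Hom A (lX a) a;
  lfixed_tri : forall a : objs F, LF (LSeq (lnu a) (liota a) (lpi a));
  lfixed_cov : forall a : objs F, is_precover X (lpi a)
}.

Section LeftInduced.
Variables (A : addcat) (O : addfun A A) (F X : addsub A) (LF : lseq O -> Prop).
Hypothesis plt : partial_left_triangulated F X LF.
Variable fx : lfixed F X LF.

Let opt (a : objs F) : rseq (opF O) :=
  @RSeq (op A) (opF O) (oval a) (lX fx a) (lU fx a)
    (lpi fx a) (liota fx a) (lnu fx a).

Lemma lU_in (a : objs F) : F (lU fx a).
Proof. by have [] := prt_seq plt (lfixed_tri fx a : LF (lseq_of_op (opt a))). Qed.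

Definition OmegaX_ob (a : objs F) : objs F := InSub (lU_in a).

Definition lkappa_rel (a b : objs F) (f : @Hom A a b)
    (k : @Hom A (OmegaX_ob a) (OmegaX_ob b)) : Prop :=
  exists sg : Hom (lX fx a) (lX fx b),
    [/\ lpi fx b ∘ sg = f ∘ lpi fx a, liota fx b ∘ k = sg ∘ liota fx a &
        k ∘ lnu fx a = lnu fx b ∘ fmap O f].

Definition OmegaX_rel : indrel X OmegaX_ob.
Proof.
refine (@IndRel _ _ _ _ _ lkappa_rel _ _ _ _ _).
- move=> a b f; have [_ mi] := lfixed_cov fx b.
  have [Xa _] := lfixed_cov fx a.
  have [sg sgE] := mi _ (f ∘ lpi fx a) Xa.
  have [k [_ k2 k3]] := prt3 plt (s := opt b) (t := opt a) (al := f) (be := sg)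
    (lfixed_tri fx b) (lfixed_tri fx a) sgE.
  by exists k, sg; split=> //; exact: esym k3.
- by move=> a; exists (idm _); rewrite fmap1 !comp1m !compm1.
- move=> a b c f g f' g' [s [s1 s2 s3]] [t [t1 t2 t3]]; exists (t ∘ s).
  split.
  + by rewrite compA t1 -!compA s1.
  + by rewrite compA t2 -!compA s2.
  + by rewrite -compA s3 !compA t3 fmapM compA.
- move=> a b f g f' g' [s [s1 s2 s3]] [t [t1 t2 t3]]; exists (s + t).
  by rewrite fmapD !compDl !compDr s1 s2 s3 t1 t2 t3.
- move=> a b f f' [s [s1 s2 s3]] /factorsP[x [u [v [Xx fE]]]].
  have [_ mi] := lfixed_cov fx b; have [Xa _] := lfixed_cov fx a.
  have [w wE] := mi _ v Xx.
  have [|l lE] := prt2 plt (s := opt b) (t := opt a) (al := f) (be := s)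
    (ga := f') (lfixed_tri fx b) (lfixed_tri fx a) Xa
    (And3 s1 s2 (esym s3)).
    by exists (w ∘ u); rewrite /= compA wE.
  by apply/factorsP; exists (lX fx a), (liota fx a), l.
Defined.

Definition OmegaX : addfun (stable F X) (stable F X) := indF OmegaX_rel.

Definition NablaX (s : lseq OmegaX) : Prop :=
  exists (k a b : objs F) (u : Hom (O b) (oval k)) (v : @Hom A k a)
    (f : @Hom A a b) (de : Hom (lX fx b) (oval a))
    (ze : @Hom A (OmegaX_ob b) k),
    [/\ LF (LSeq u v f) /\ is_epic X f,
        f ∘ de = lpi fx b, v ∘ ze = de ∘ liota fx b, ze ∘ lnu fx b = u &
        liso (@LSeq (stable F X) OmegaX k a b
                (scls X ze) (scls X v) (scls X f)) s].

End LeftInduced.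

Record special_preenveloping (A : addcat) (S : addfun A A) (C X : addsub A)
    (RC : rseq S -> Prop) (G : addsub A) := SpecialPre {
  spX : subcat_le X G;
  spC : subcat_le G C;
  spR : objs C -> A;
  spW : objs C -> A;
  spj : forall a : objs C, @Hom A a (spR a);
  spg : forall a : objs C, Hom (spR a) (spW a);
  sph : forall a : objs C, Hom (spW a) (S a);
  sp_tri : forall a : objs C, RC (RSeq (spj a) (spg a) (sph a));
  sp_env : forall a : objs C, is_preenvelope G (spj a);
  sp_orth : forall (a : objs C) (b : A), G b ->
    forall f : qHom X (spW a) b, f = 0
}.

Section RightStabilizing.
Variables (A : addcat) (S : addfun A A) (C X : addsub A) (RC : rseq S -> Prop).
Hypothesis prt : partial_right_triangulated C X RC.
Variables (fx : rfixed C X RC) (G : addsub A).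
Variable sp : special_preenveloping C X RC G.

Definition R_ob (a : objs C) : objs G := InSub (proj1 (sp_env sp a)).

Definition hat_rel (a b : objs C) (f : @Hom A a b)
    (f' : @Hom A (R_ob a) (R_ob b)) : Prop :=
  f' ∘ spj sp a = spj sp b ∘ f.

Definition R_rel : indrel X R_ob.
Proof.
refine (@IndRel _ _ _ _ _ hat_rel _ _ _ _ _).
- move=> a b f; have [_ mi] := sp_env sp a; have [Gb _] := sp_env sp b.
  by have [f' f'E] := mi _ (spj sp b ∘ f) Gb; exists f'.
- by move=> a; rewrite /hat_rel comp1m compm1.
- move=> a b c f g f' g' rf rg.
  by rewrite /hat_rel -compA rf !compA rg.
- by move=> a b f g f' g' rf rg; rewrite /hat_rel compDl compDr rf rg.
- move=> a b f f' rf /factorsP[x [u [v [Xx fE]]]].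
  have [_ mi] := sp_env sp a; have [Gb _] := sp_env sp b.
  have [w wE] := mi _ u (spX sp Xx).
  have [_ wc _] := prt_seq prt (sp_tri sp a).
  have /wc[t /= tE] : (f' - spj sp b ∘ v ∘ w) ∘ spj sp a = 0.
    by rewrite compBl rf -(compA _ w) wE fE compA subrr.
  have /cls_eq : cls X t = cls X 0 by rewrite cls0; exact: (sp_orth Gb).
  rewrite subr0 => tX; rewrite -(subrK (spj sp b ∘ v ∘ w) f') tE.
  apply: rpredD; first exact: factors_precomp.
  by apply/factorsP; exists x, w, (spj sp b ∘ v).
Defined.

Definition RF : addfun (stable C X) (stable G X) := indF R_rel.

Definition EC : addfun (stable G X) (stable C X) := inclF X (spC sp).

Definition jcls (a : objs C) : @Hom (stable C X) a (EC (RF a)) :=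
  @scls A C X a (osub (spC sp) (R_ob a)) (spj sp a).

Definition right_stabilizing : Prop :=
  forall (a b c d : stable C X) (f : Hom a b)
    (g : Hom b c) (h : Hom c (SigmaX prt fx a))
    (k : Hom (EC (RF b)) d) (l : Hom d (SigmaX prt fx (EC (RF a)))),
    DeltaX (RSeq f g h) ->
    DeltaX (RSeq (fmap EC (fmap RF f)) k l) ->
    exists t : Hom c d,
      rmor (s := RSeq f g h) (t := RSeq (fmap EC (fmap RF f)) k l)
        (jcls a) (jcls b) t /\
      isiso (fmap RF t).

Definition GX : addfun (stable G X) (stable G X) :=
  compF RF (compF (SigmaX prt fx) EC).

(* For b in G the identification of b with R(b) is made through the class of
   j^b : b -> R(b), an isomorphism of G/X. *)
Definition jG (b : objs G) : @Hom (stable G X) b (RF (EC b)) :=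
  @scls A G X b (R_ob (osub (spC sp) b)) (spj sp (osub (spC sp) b)).

Definition DeltaGX (s : rseq GX) : Prop :=
  exists (a b : stable G X) (c : stable C X) (f : Hom a b)
    (g : Hom (EC b) c) (h : Hom c (SigmaX prt fx (EC a))),
    DeltaX (RSeq (fmap EC f) g h) /\
    riso (@RSeq (stable G X) GX a b (RF c)
            f (fmap RF g ∘ jG b) (fmap RF h)) s.

End RightStabilizing.

Record special_precovering (A : addcat) (O : addfun A A) (F X : addsub A)
    (LF : lseq O -> Prop) (G : addsub A) := SpecialCov {
  scX : subcat_le X G;
  scF : subcat_le G F;
  scQ : objs F -> A;
  scW : objs F -> A;
  sch : forall a : objs F, Hom (O a) (scW a);
  scg : forall a : objs F, Hom (scW a) (scQ a);
  scr : forall a : objs F, @Hom A (scQ a) a;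
  sc_tri : forall a : objs F, LF (LSeq (sch a) (scg a) (scr a));
  sc_cov : forall a : objs F, is_precover G (scr a);
  sc_orth : forall (a : objs F) (b : A), G b ->
    forall f : qHom X b (scW a), f = 0
}.

Section LeftStabilizing.
Variables (A : addcat) (O : addfun A A) (F X : addsub A) (LF : lseq O -> Prop).
Hypothesis plt : partial_left_triangulated F X LF.
Variables (fx : lfixed F X LF) (G : addsub A).
Variable sc : special_precovering F X LF G.

Definition Q_ob (a : objs F) : objs G := InSub (proj1 (sc_cov sc a)).

Definition check_rel (a b : objs F) (f : @Hom A a b)
    (f' : @Hom A (Q_ob a) (Q_ob b)) : Prop :=
  scr sc b ∘ f' = f ∘ scr sc a.

Definition Q_rel : indrel X Q_ob.
Proof.
refine (@IndRel _ _ _ _ _ check_rel _ _ _ _ _).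
- move=> a b f; have [_ mi] := sc_cov sc b; have [Ga _] := sc_cov sc a.
  by have [f' f'E] := mi _ (f ∘ scr sc a) Ga; exists f'.
- by move=> a; rewrite /check_rel comp1m compm1.
- move=> a b c f g f' g' rf rg.
  by rewrite /check_rel compA rg -!compA rf.
- by move=> a b f g f' g' rf rg; rewrite /check_rel compDl compDr rf rg.
- move=> a b f f' rf /factorsP[x [u [v [Xx fE]]]].
  have [_ mi] := sc_cov sc b; have [Ga _] := sc_cov sc a.
  have [w wE] := mi _ v (scX sc Xx).
  have [_ wc _] := prt_seq plt (s := @RSeq (op A) (opF O) (oval b) _ _
    (scr sc b) (scg sc b) (sch sc b)) (sc_tri sc b).
  have /wc[t /= tE] : scr sc b ∘ (f' - w ∘ (u ∘ scr sc a)) = 0.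
    by rewrite compBr rf (compA _ w) wE fE compA subrr.
  have /cls_eq : cls X t = cls X 0 by rewrite cls0; exact: (sc_orth Ga).
  rewrite subr0 => tX; rewrite -(subrK (w ∘ (u ∘ scr sc a)) f') tE.
  apply: rpredD; first exact: factors_postcomp.
  by apply/factorsP; exists x, (u ∘ scr sc a), w.
Defined.

Definition QF : addfun (stable F X) (stable G X) := indF Q_rel.

Definition EF : addfun (stable G X) (stable F X) := inclF X (scF sc).

Definition rcls (a : objs F) : @Hom (stable F X) (EF (QF a)) a :=
  @scls A F X (osub (scF sc) (Q_ob a)) a (scr sc a).

Definition left_stabilizing : Prop :=
  forall (a b k l : stable F X) (f : Hom a b)
    (v : Hom (OmegaX plt fx (EF (QF b))) k) (u : Hom k (EF (QF a)))
    (v' : Hom (OmegaX plt fx b) l) (u' : Hom l a),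
    NablaX (LSeq v u (fmap EF (fmap QF f))) ->
    NablaX (LSeq v' u' f) ->
    exists s : Hom k l,
      lmor (s := LSeq v u (fmap EF (fmap QF f))) (t := LSeq v' u' f)
        s (rcls a) (rcls b) /\
      isiso (fmap QF s).

Definition HX : addfun (stable G X) (stable G X) :=
  compF QF (compF (OmegaX plt fx) EF).

(* For a in G the identification of Q(a) with a is made through the class of
   r_a : Q(a) -> a, an isomorphism of G/X. *)
Definition rG (a : objs G) : @Hom (stable G X) (QF (EF a)) a :=
  @scls A G X (Q_ob (osub (scF sc) a)) a (scr sc (osub (scF sc) a)).

Definition NablaGX (s : lseq HX) : Prop :=
  exists (a b : stable G X) (k : stable F X)
    (v : Hom (OmegaX plt fx (EF b)) k) (u : Hom k (EF a)) (f : Hom a b),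
    NablaX (LSeq v u (fmap EF f)) /\
    liso (@LSeq (stable G X) HX (QF k) a b
            (fmap QF v) (rG a ∘ fmap QF u) f) s.

End LeftStabilizing.

(* O is left adjoint to S. In pp_c and pp_e the X-monic f is not required to lie
   in C, nor is the X-epic w of pp_c and pp_d required to lie in F. *)
Record pre_partial_triangulated (A : addcat) (O S : addfun A A)
    (F C X : addsub A) (LF : lseq O -> Prop) (RC : rseq S -> Prop) :=
  PrePartial {
  pp_right : partial_right_triangulated C X RC;
  pp_left : partial_left_triangulated F X LF;
  pp_rfix : rfixed C X RC;
  pp_lfix : lfixed F X LF;
  pp_adj : adjunction O S;
  pp_pre : special_preenveloping C X RC (subcatI C F);
  pp_cov : special_precovering F X LF (subcatI C F);
  pp_rstab : right_stabilizing pp_right pp_rfix pp_pre;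
  pp_lstab : left_stabilizing pp_left pp_lfix pp_cov;
  pp_c : forall (a b c l m n : A)
      (f : Hom a b) (g : Hom b c) (h : Hom c (S a))
      (u : Hom (O n) l) (v : Hom l m) (w : Hom m n) (be : Hom b m),
    RC (RSeq f g h) -> is_monic X f -> LF (LSeq u v w) -> is_epic X w ->
    (forall ga : Hom c n, ga ∘ g = w ∘ be ->
      exists al : Hom a l,
        v ∘ al = be ∘ f /\ u ∘ fmap O ga = - (al ∘ adj_psiV pp_adj h)) /\
    (forall al : Hom a l, v ∘ al = be ∘ f ->
      exists ga : Hom c n,
        ga ∘ g = w ∘ be /\ fmap S al ∘ h = - (adj_psi pp_adj u ∘ ga));
  pp_d : forall (a : objs C) (l m n : A)
      (u : Hom (O n) l) (v : Hom l m) (w : Hom m n)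
      (al : Hom (oval a) l) (be : Hom (rX pp_rfix a) m)
      (ga : Hom (rU pp_rfix a) n),
    F a -> LF (LSeq u v w) -> is_epic X w ->
    v ∘ al = be ∘ ri pp_rfix a -> w ∘ be = ga ∘ rp pp_rfix a ->
    u ∘ fmap O ga = - (al ∘ adj_psiV pp_adj (rq pp_rfix a)) ->
    (exists k : Hom (rU pp_rfix a) m, ga = w ∘ k) ->
    exists k : Hom (rX pp_rfix a) l, al = k ∘ ri pp_rfix a;
  pp_e : forall (d : objs F) (a b c : A)
      (f : Hom a b) (g : Hom b c) (h : Hom c (S a))
      (al : Hom a (lU pp_lfix d)) (be : Hom b (lX pp_lfix d))
      (ga : Hom c (oval d)),
    C d -> RC (RSeq f g h) -> is_monic X f ->
    liota pp_lfix d ∘ al = be ∘ f -> lpi pp_lfix d ∘ be = ga ∘ g ->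
    fmap S al ∘ h = - (adj_psi pp_adj (lnu pp_lfix d) ∘ ga) ->
    (exists k : Hom b (lU pp_lfix d), al = k ∘ f) ->
    exists k : Hom c (lX pp_lfix d), ga = lpi pp_lfix d ∘ k
}.

(* Main.v *)
(* Write G for the intersection of C and F.  First C/X is right triangulated: a
   right triangle over f : A -> B is, up to stable isomorphism, the one over the
   X-monic (i,f) : A -> X^A + B, and PRT4 applied to (1,f) : A -> A + B and
   i + 1 : A + B -> X^A + B rotates that one.  Octahedra need only be found for
   one choice of triangles, and (i,f), 1 + (i,g) is a composable pair of
   X-monics representing (f,g) to which PRT4 applies.  Next, the right
   triangulation descends along the reflection R : C/X -> G/X, because the
   stabilizing condition says that R f has a triangle that is R of a triangle of
   f.  The left triangulation is the same result in the opposite category.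
   Finally, the morphisms from A -> X^A -> U^A to U_D -> X_D -> D set up a
   bijection between stable morphisms U^A -> D and A -> U_D, by axioms (c), (d),
   (e); it is the adjunction of G^X and H_X, and the two gluing conditions
   follow by applying (c) to one triangle and one rotated triangle, the errors
   being killed by (d) and (e). *)
From mathcomp Require Import all_boot all_algebra boolp.
Require Import Defs.

Set Implicit Arguments.
Unset Strict Implicit.
Unset Printing Implicit Defensive.

Import GRing.Theory.
Local Open Scope ring_scope.

(** * Right triangles in an additive category *)

(** Squares in a stable category commute only up to morphisms factoring through [X], while the
    axioms speak of strict diagrams in [A]. Such an error extends along an [X]-monic, or lifts along
    an [X]-epic, and can then be subtracted from the next component; this makes diagrams strict. In
    the other direction, PRT2 kills the third component of a ladder into a fixed triangle when the
    first component vanishes; this gives the identities between connecting morphisms.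

    Third components of ladders are not unique, so ladders over mutually inverse isomorphisms need
    not compose to identities. Their composites are only unipotent, which is still enough to make
    them invertible.

    A right triangle is determined up to isomorphism by its first map and a left triangle by its
    last. Gluing therefore needs proof only for explicit cones and cocones, whose underlying rows in
    [RC] and [LF] are known and can be fed to (c), (d) and (e). *)

Section AdditiveFunctors.
Variables (A B : addcat) (F : addfun A B).

Lemma fmap0 (a b : A) : fmap F (0 : Hom a b) = 0.
Proof. by apply: (addrI (fmap F 0)); rewrite -fmapD !addr0. Qed.

Lemma fmapN (a b : A) (f : Hom a b) : fmap F (- f) = - fmap F f.
Proof. by apply: (addrI (fmap F f)); rewrite -fmapD !subrr fmap0. Qed.

Lemma isiso_fmap (a b : A) (f : Hom a b) : isiso f -> isiso (fmap F f).
Proof. by case=> g [gf fg]; exists (fmap F g); rewrite -!fmapM gf fg !fmap1. Qed.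

End AdditiveFunctors.

Section Isomorphisms.
Variable A : addcat.

Lemma isiso1 (a : A) : isiso (idm a).
Proof. by exists (idm a); rewrite comp1m. Qed.

Lemma isisoM (a b c : A) (g : Hom b c) (f : Hom a b) :
  isiso g -> isiso f -> isiso (g ∘ f).
Proof.
case=> g' [g'g gg'] [f' [f'f ff']]; exists (f' ∘ g'); split.
  by rewrite -compA (compA g') g'g comp1m.
by rewrite -compA (compA f) ff' comp1m.
Qed.

Lemma isisoN (a b : A) (f : Hom a b) : isiso f -> isiso (- f).
Proof. by case=> g [gf fg]; exists (- g); rewrite !compNm !compmN !opprK. Qed.


Lemma isiso_linv_rinv (a b : A) (f : Hom a b) (l r : Hom b a) :
  l ∘ f = idm a -> f ∘ r = idm b -> isiso f.
Proof.
move=> lf fr; exists l; split=> //.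
by rewrite -[in LHS](compm1 l) -fr (compA l) lf comp1m.
Qed.

Lemma isiso_split (a b : A) (f : Hom a b) (g : Hom b a) :
  isiso (g ∘ f) -> isiso (f ∘ g) -> isiso f.
Proof.
case=> l [lE _] [r [_ rE]].
by apply: (@isiso_linv_rinv _ _ f (l ∘ g) (g ∘ r)); rewrite -?compA // compA.
Qed.

Lemma isiso_unipotent (a : A) (n : Hom a a) : n ∘ n = 0 -> isiso (idm a + n).
Proof.
move=> nn; exists (idm a - n).
by split; rewrite !(compDl, compDr) ?compNm ?compmN !comp1m !compm1 nn oppr0 addr0;
  rewrite ?addrK ?subrK.
Qed.

Lemma hom_to0 (a b : A) (f : Hom a b) : idm b = 0 -> f = 0.
Proof. by move=> b0; rewrite -(comp1m f) b0 comp0m. Qed.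

Lemma hom_from0 (a b : A) (f : Hom a b) : idm a = 0 -> f = 0.
Proof. by move=> a0; rewrite -(compm1 f) a0 compm0. Qed.

Lemma bip_from (a b c : A) (f g : Hom (bip a b) c) :
  f ∘ in1 a b = g ∘ in1 a b -> f ∘ in2 a b = g ∘ in2 a b -> f = g.
Proof.
move=> e1 e2; rewrite -(compm1 f) -(compm1 g) -bipP !compDr !compA.
by rewrite e1 e2.
Qed.

Lemma pr1in1K (a b c : A) (f : Hom c a) : pr1 a b ∘ (in1 a b ∘ f) = f.
Proof. by rewrite compA pr1in1 comp1m. Qed.
Lemma pr2in2K (a b c : A) (f : Hom c b) : pr2 a b ∘ (in2 a b ∘ f) = f.
Proof. by rewrite compA pr2in2 comp1m. Qed.
Lemma pr1in2K (a b c : A) (f : Hom c b) : pr1 a b ∘ (in2 a b ∘ f) = 0.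
Proof. by rewrite compA pr1in2 comp0m. Qed.
Lemma pr2in1K (a b c : A) (f : Hom c a) : pr2 a b ∘ (in1 a b ∘ f) = 0.
Proof. by rewrite compA pr2in1 comp0m. Qed.

Definition pr_inE := (pr1in1, pr2in2, pr1in2, pr2in1,
  pr1in1K, pr2in2K, pr1in2K, pr2in1K).
End Isomorphisms.

Ltac bip_simp :=
  repeat progress rewrite ?compDl ?compDr -?compA ?pr_inE ?comp1m ?compm1 ?comp0m ?compm0
    ?addr0 ?add0r ?compNm ?compmN ?oppr0 ?opprK ?fmap1 ?fmap0.

Section Sequences.
Variables (T : addcat) (S : addfun T T).
Implicit Types s t : rseq S.

Lemma rmorM s t r (al : Hom (rA s) (rA t)) be ga (al' : Hom (rA t) (rA r)) be' ga' :
  rmor al be ga -> rmor al' be' ga' -> rmor (al' ∘ al) (be' ∘ be) (ga' ∘ ga).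
Proof.
case=> e1 e2 e3 [f1 f2 f3]; split.
- by rewrite -compA e1 !compA f1.
- by rewrite -compA e2 !compA f2.
- by rewrite fmapM -compA e3 !compA f3.
Qed.

Lemma riso_inv s t : riso s t ->
  exists (al : Hom (rA s) (rA t)) (be : Hom (rB s) (rB t)) (ga : Hom (rC s) (rC t))
    (al' : Hom (rA t) (rA s)) (be' : Hom (rB t) (rB s)) (ga' : Hom (rC t) (rC s)),
  [/\ rmor al be ga, rmor al' be' ga',
      al' ∘ al = idm _ /\ al ∘ al' = idm _,
      be' ∘ be = idm _ /\ be ∘ be' = idm _ &
      ga' ∘ ga = idm _ /\ ga ∘ ga' = idm _].
Proof.
case=> al [be [ga [[e1 e2 e3] [al' [ala aal]] [be' [beb bbe]] [ga' [gag gga]]]]].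
exists al, be, ga, al', be', ga'; split=> //; split.
- by rewrite -[LHS]compm1 -aal -compA (compA _ al) -e1 compA (compA _ be) beb comp1m.
- by rewrite -[LHS]compm1 -bbe -compA (compA _ be) -e2 compA (compA _ ga) gag comp1m.
- rewrite -[LHS]compm1 -gga -compA (compA _ ga) -e3 compA (compA _ (fmap S al)).
  by rewrite -fmapM ala fmap1 comp1m.
Qed.

Lemma riso_sym s t : riso s t -> riso t s.
Proof.
case/riso_inv=> al [be [ga [al' [be' [ga' [_ m [? ?] [? ?] [? ?]]]]]]].
by exists al', be', ga'; split=> //; [exists al | exists be | exists ga].
Qed.

Lemma riso_trans s t r : riso s t -> riso t r -> riso s r.
Proof.
case=> al [be [ga [m ai bi ci]]] [al' [be' [ga' [m' ai' bi' ci']]]].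
exists (al' ∘ al), (be' ∘ be), (ga' ∘ ga).
by split; [exact: rmorM | exact: isisoM | exact: isisoM | exact: isisoM].
Qed.

Lemma riso_refl s : riso s s.
Proof.
exists (idm _), (idm _), (idm _); split; try exact: isiso1.
by split; rewrite ?fmap1 ?comp1m ?compm1.
Qed.

Definition rot s : rseq S := RSeq (rg s) (rh s) (- fmap S (rf s)).

Lemma riso_rot s t : riso s t -> riso (rot s) (rot t).
Proof.
case=> al [be [ga [[e1 e2 e3] ai bi ci]]].
exists be, ga, (fmap S al); split=> //; last exact: isiso_fmap.
split=> //=.
by rewrite compNm compmN -!fmapM e1.
Qed.

Definition iso_closure (D : rseq S -> Prop) s := exists2 s0, D s0 & riso s0 s.

(** The classes of triangles below are closures of explicit ones; this restricts the search for
    third components to the explicit ones. *)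
Lemma ladder_iso_closure (D : rseq S -> Prop) :
  ladder_completion D -> ladder_completion (iso_closure D).
Proof.
move=> lad s t al be [s0 Ds0 /riso_inv[a [b [c [a' [b' [c' [m m' ai bi ci]]]]]]]].
move=> [t0 Dt0 /riso_inv[x [y [z [x' [y' [z' [n n' xi yi zi]]]]]]]] sq.
have [|ga mg] := lad s0 t0 (x' ∘ (al ∘ a)) (y' ∘ (be ∘ b)) Ds0 Dt0.
  case: m n' => m1 m2 m3 [n1 n2 n3].
  by rewrite -!compA m1 (compA be) sq !compA n1.
exists (z ∘ (ga ∘ c')).
have := rmorM (rmorM m' mg) n.
congr (rmor _ _ _).
- by rewrite -!compA ai.2 compm1 !compA xi.2 comp1m.
- by rewrite -!compA bi.2 compm1 !compA yi.2 comp1m.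
Qed.

Lemma riso_same_ends (a b c c' : T) (f : Hom a b) (g : Hom b c) (h : Hom c (S a))
    (g' : Hom b c') (h' : Hom c' (S a)) (k : Hom c c') :
  isiso k -> k ∘ g = g' -> h = h' ∘ k -> riso (RSeq f g h) (RSeq f g' h').
Proof.
move=> ki kg hk; exists (idm a), (idm b), k; split=> //; try exact: isiso1.
by split; rewrite /= ?fmap1 ?comp1m ?compm1.
Qed.

End Sequences.

(** * Uniqueness of triangles and the reduction of the octahedral axiom *)

Section FiveLemma.
Variables (T : addcat) (S : addfun T T) (D : rseq S -> Prop).
Hypothesis Diso : forall s t, riso s t -> D s -> D t.
Hypothesis Did : forall a : T, D (@RSeq T S (zob T) a a 0 (idm a) 0).
Hypothesis Drot : forall s, D s -> D (rot s).
Hypothesis Dlad : ladder_completion D.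

(** The pair [(0, u)] starts a ladder to the triangle [0 -> m -> m -> S 0], and its third component
    is the factor. *)
Lemma tri_wcok s (m : T) (u : Hom (rB s) m) :
  D s -> u ∘ rf s = 0 -> exists v, u = v ∘ rg s.
Proof.
move=> Ds u0; pose t := @RSeq T S (zob T) m m 0 (idm m) 0.
have [|ga [/= _ e2 _]] := @Dlad s t 0 u Ds (Did m).
  by rewrite u0 compm0.
by exists ga; rewrite e2 comp1m.
Qed.

(** Since [k - 1] kills the second map, it factors through the third one, which in turn kills
    [k - 1]. Hence [k - 1] has square zero. *)
Lemma tri_unipotent s (k : Hom (rC s) (rC s)) :
  D s -> k ∘ rg s = rg s -> rh s ∘ k = rh s -> isiso k.
Proof.
move=> Ds kg hk.
have [|y yE] := @tri_wcok (rot s) _ (k - idm _) (Drot Ds).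
  by rewrite /= compBl kg comp1m subrr.
rewrite -(subrKC (idm _) k); apply: isiso_unipotent.
by rewrite {1}yE -compA compBr hk /= compm1 subrr compm0.
Qed.

(** A ladder in the opposite direction over the inverses of [al] and [be] has a third component
    [ga']; both composites with [ga] are unipotent, hence invertible. *)
Lemma tri_five s t (al : Hom (rA s) (rA t)) be ga :
  D s -> D t -> rmor al be ga -> isiso al -> isiso be -> isiso ga.
Proof.
move=> Ds Dt m [al' [ala aal]] [be' [beb bbe]]; have [e1 e2 e3] := m.
have [|ga' m'] := @Dlad t s al' be' Dt Ds.
  by rewrite -[LHS]compm1 -aal -compA (compA _ al) -e1 compA (compA _ be) beb comp1m.
apply: (@isiso_split _ _ _ ga ga').
  have [_ f2 f3] := rmorM m m'.
  by apply: (tri_unipotent Ds); rewrite ?f2 -?f3 ?beb ?ala ?fmap1 ?compm1 ?comp1m.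
have [_ f2 f3] := rmorM m' m.
by apply: (tri_unipotent Dt); rewrite ?f2 -?f3 ?bbe ?aal ?fmap1 ?compm1 ?comp1m.
Qed.

Lemma tri_iso (a b c a1 b1 c1 : T) (f : Hom a b) (g : Hom b c) (h : Hom c (S a))
    (f1 : Hom a1 b1) (g1 : Hom b1 c1) (h1 : Hom c1 (S a1))
    (al : Hom a a1) (be : Hom b b1) :
  D (RSeq f g h) -> D (RSeq f1 g1 h1) -> be ∘ f = f1 ∘ al ->
  isiso al -> isiso be ->
  exists ga, [/\ ga ∘ g = g1 ∘ be, fmap S al ∘ h = h1 ∘ ga & isiso ga].
Proof.
move=> Ds Dt sq ai bi.
have [ga m] := @Dlad (RSeq f g h) (RSeq f1 g1 h1) al be Ds Dt sq.
have [_ e2 e3] := m; exists ga; split=> //.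
exact: (@tri_five (RSeq f g h) (RSeq f1 g1 h1)) m ai bi.
Qed.

(* An octahedron for one choice of triangles, over composable morphisms
   isomorphic to the given ones, yields all octahedra. *)
Definition octahedron_upto_iso : Prop :=
  forall (a b c : T) (f : Hom a b) (g : Hom b c),
  exists (b1 c1 : T) (be : Hom b b1) (ga : Hom c c1) (g1 : Hom b1 c1)
    (c' a' b' : T) (l : Hom b1 c') (m : Hom c' (S a))
    (h : Hom c1 a') (j : Hom a' (S b1)) (u : Hom c1 b') (v : Hom b' (S a))
    (r : Hom c' b') (s : Hom b' a'),
  [/\ isiso be, isiso ga & g1 ∘ be = ga ∘ g] /\
  [/\ D (RSeq (be ∘ f) l m), D (RSeq g1 h j) & D (RSeq (g1 ∘ (be ∘ f)) u v)] /\
  [/\ r ∘ l = u ∘ g1, v ∘ r = m, s ∘ u = h & j ∘ s = fmap S (be ∘ f) ∘ v] /\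
  D (RSeq r s (fmap S l ∘ j)).

Lemma octahedron_of_upto_iso : octahedron_upto_iso ->
  octahedron D (fun _ _ _ => True) (fun _ _ _ => True).
Proof.
move=> oct a b c c' a' b' f g l m h j u v _ _ Df Dg Dgf.
have [b1 [c1 [be [ga [g1 [c1' [a1' [b1' [l1 [m1 [h1 [j1 [u1 [v1 [r1 [s1]]]]]]]]]]]]]]]]
  := oct a b c f g.
move=> [[bi ci gE] [[Df1 Dg1 Dgf1] [[e1 e2 e3 e4] Dr1]]].
have [|x [x2 x3 xi]] := tri_iso Df Df1 _ (isiso1 a) bi.
  by rewrite compm1.
have [y [y2 y3 yi]] := tri_iso Dg Dg1 (esym gE) bi ci.
have [|z [z2 z3 zi]] := tri_iso Dgf Dgf1 _ (isiso1 a) ci.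
  by rewrite compm1 /= !compA gE.
have [z' [zz' z'z]] := zi; have [y' [yy' y'y]] := yi.
have [be' [bb' b'b]] := bi.
rewrite fmap1 comp1m in x3; rewrite fmap1 comp1m in z3.
exists (z' ∘ (r1 ∘ x)), (y' ∘ (s1 ∘ z)).
have rE : z ∘ (z' ∘ (r1 ∘ x)) = r1 ∘ x by rewrite compA z'z comp1m.
have sE : y ∘ (y' ∘ (s1 ∘ z)) = s1 ∘ z by rewrite compA y'y comp1m.
split; split=> //.
- rewrite -!compA x2 (compA r1) e1 -compA gE (compA u1) -z2 !compA zz'.
  by rewrite comp1m.
- by rewrite z3 -compA rE compA e2.
- by rewrite -!compA z2 (compA s1) e3 -y2 compA yy' comp1m.
(* The comparison of the triangles over [g] and [g1] lies over [be], so the identity is first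
   obtained after composing with [fmap S be], which is then cancelled. *)
- have e : fmap S be ∘ (j ∘ (y' ∘ (s1 ∘ z))) = fmap S be ∘ (fmap S f ∘ v).
    by rewrite compA y3 -compA sE compA e4 fmapM -!compA -z3.
  have := congr1 (fun w => fmap S be' ∘ w) e.
  by rewrite /= !compA -!fmapM bb' fmap1 !comp1m.
- apply: Diso Dr1; apply: riso_sym; exists x, z, y; split=> //; split=> //=.
  by rewrite compA -fmapM x2 fmapM -!compA y3.
Qed.

Lemma right_triangulated_of_upto_iso :
  (forall (a b : T) (f : Hom a b), exists c g h, D (@RSeq T S a b c f g h)) ->
  octahedron_upto_iso -> right_triangulated D.
Proof.
move=> Dex oct; split=> //; first by move=> a b c f g h /Drot.
exact: octahedron_of_upto_iso.
Qed.

End FiveLemma.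

(** Used to replace an arbitrary triangle over [f] by the cone of a lift of [f]. *)
Lemma rt_same_first (T : addcat) (S : addfun T T) (D : rseq S -> Prop)
    (a b c c' : T) (f : Hom a b) (g : Hom b c) (h : Hom c (S a))
    (g' : Hom b c') (h' : Hom c' (S a)) : right_triangulated D ->
  D (RSeq f g h) -> D (RSeq f g' h') ->
  exists k, [/\ isiso k, k ∘ g = g' & h = h' ∘ k].
Proof.
move=> [Diso _ Did Drot Dlad _] Ds Dt.
have Drot' s : D s -> D (rot s) by case: s => ? ? ? ? ? ? /Drot.
have [|ga [e2 e3 gi]] := tri_iso Did Drot' Dlad Ds Dt _ (isiso1 a) (isiso1 b).
  by rewrite comp1m compm1.
by exists ga; rewrite -e3 e2 fmap1 comp1m compm1.
Qed.

(** * Partial right triangulated categories *)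

Section PartialRightTheory.
Variables (A : addcat) (S : addfun A A) (C X : addsub A) (RC : rseq S -> Prop).
Hypothesis prt : partial_right_triangulated C X RC.

Lemma preenvelope_factors (a b x : A) (i : Hom a x) (f : Hom a b) :
  is_preenvelope X i -> f \in factors X a b -> exists k, f = k ∘ i.
Proof.
case=> Xx mi /factorsP[y [u [v [Xy ->]]]]; have [w <-] := mi _ u Xy.
by exists (v ∘ w); rewrite compA.
Qed.

Lemma RC_comp0 (a b c : A) (f : Hom a b) (g : Hom b c) (h : Hom c (S a)) :
  RC (RSeq f g h) -> g ∘ f = 0 /\ h ∘ g = 0.
Proof.
move=> /(prt_seq prt)[_ w1 w2]; split.
- by apply/w1; exists (idm _); rewrite comp1m.
- by apply/w2; exists (idm _); rewrite comp1m.
Qed.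

Lemma RC_wcok1 (a b c m : A) (f : Hom a b) (g : Hom b c) (h : Hom c (S a))
    (u : Hom b m) :
  RC (RSeq f g h) -> u ∘ f = 0 -> exists v, u = v ∘ g.
Proof. by move=> /(prt_seq prt)[_ w1 _] /w1. Qed.

Lemma RC_wcok2 (a b c m : A) (f : Hom a b) (g : Hom b c) (h : Hom c (S a))
    (u : Hom c m) :
  RC (RSeq f g h) -> u ∘ g = 0 -> exists v, u = v ∘ h.
Proof. by move=> /(prt_seq prt)[_ _ w2] /w2. Qed.

Lemma RC_ladder (a b c a' b' c' : A) (f : Hom a b) (g : Hom b c) (h : Hom c (S a))
    (f' : Hom a' b') (g' : Hom b' c') (h' : Hom c' (S a'))
    (al : Hom a a') (be : Hom b b') :
  RC (RSeq f g h) -> RC (RSeq f' g' h') -> be ∘ f = f' ∘ al ->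
  exists ga, ga ∘ g = g' ∘ be /\ h' ∘ ga = fmap S al ∘ h.
Proof.
move=> Rs Rt sq.
have [ga [_ e2 e3]] := @prt3 _ _ _ _ _ prt (RSeq f g h) (RSeq f' g' h') al be Rs Rt sq.
by exists ga.
Qed.

(* The case alpha = 0 of PRT2. *)
Lemma RC_null (a b c a' b' c' : A) (f : Hom a b) (g : Hom b c) (h : Hom c (S a))
    (f' : Hom a' b') (g' : Hom b' c') (h' : Hom c' (S a'))
    (be : Hom b b') (ga : Hom c c') :
  RC (RSeq f g h) -> RC (RSeq f' g' h') -> X b' ->
  be ∘ f = 0 -> ga ∘ g = g' ∘ be -> h' ∘ ga = 0 -> ga \in factors X c c'.
Proof.
move=> Rs Rt Xb e1 e2 e3.
have [||l ->] := @prt2 _ _ _ _ _ prt (RSeq f g h) (RSeq f' g' h') 0 be ga Rs Rt Xb.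
- by split; rewrite /= ?e1 ?compm0 ?fmap0 ?comp0m ?e3.
- by exists 0; rewrite comp0m.
by apply/factorsP; exists b', l, g'.
Qed.

(** The argument of [tri_unipotent], now in [A] itself, where the weak cokernel property is part of
    being a right sequence. *)
Lemma RC_unipotent (a b c : A) (f : Hom a b) (g : Hom b c) (h : Hom c (S a))
    (k : Hom c c) :
  RC (RSeq f g h) -> k ∘ g = g -> h ∘ k = h -> isiso k.
Proof.
move=> R kg hk; have [|y yE] := RC_wcok2 (u := k - idm c) R.
  by rewrite compBl kg comp1m subrr.
rewrite -(subrKC (idm c) k); apply: isiso_unipotent.
by rewrite {1}yE -compA compBr hk compm1 subrr compm0.
Qed.

(** The graph triangle of [b -> 0], with [b + 0] identified with [b]. *)
Lemma RC_id (b : A) : C b -> RC (@RSeq A S b b (zob A) (idm b) 0 0).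
Proof.
move=> Cb; apply: prt_iso prt _ _ _ (prt1_graph prt 0 Cb (insub0 C)).
exists (idm b), (pr1 b (zob A)), (idm _); split; try exact: isiso1; last first.
  exists (in1 b (zob A)); rewrite pr1in1; split=> //.
  apply: bip_from; bip_simp=> //.
  by rewrite (hom_from0 (in2 _ _)) // zobP.
split=> /=; bip_simp=> //.
by apply: hom_to0; exact: zobP.
Qed.

Lemma RC_0id (b : A) : C b -> RC (@RSeq A S (zob A) b b 0 (idm b) 0).
Proof.
move=> Cb; apply: prt_iso prt _ _ _ (prt1_graph prt 0 (insub0 C) Cb).
(* The minus sign cancels the one in the second map [(f, -1)] of a graph triangle. *)
exists (idm _), (- pr2 (zob A) b), (idm _); split; try exact: isiso1; last first.
  apply: isisoN; exists (in2 (zob A) b); rewrite pr2in2; split=> //.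
  apply: bip_from; bip_simp=> //.
  by rewrite (hom_from0 (in1 _ _)) // zobP.
by split=> /=; bip_simp.
Qed.

Lemma RC_sum_idr (a b c x : A) (f : Hom a b) (g : Hom b c) (h : Hom c (S a)) :
  RC (RSeq f g h) -> C x ->
  RC (@RSeq A S (bip a x) (bip b x) c
     (in1 b x ∘ f ∘ pr1 a x + in2 b x ∘ pr2 a x) (g ∘ pr1 b x)
     (fmap S (in1 a x) ∘ h)).
Proof.
move=> R Cx; apply: prt_iso prt _ _ _ (prt_sum prt R (RC_id Cx)).
exists (idm _), (idm _), (pr1 c (zob A)); split; try exact: isiso1; last first.
  exists (in1 c (zob A)); rewrite pr1in1; split=> //.
  apply: bip_from; bip_simp=> //.
  by rewrite (hom_from0 (in2 _ _)) // zobP.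
split=> /=; bip_simp=> //.
Qed.

Lemma RC_sum_idl (a b c x : A) (f : Hom a b) (g : Hom b c) (h : Hom c (S a)) :
  RC (RSeq f g h) -> C x ->
  RC (@RSeq A S (bip x a) (bip x b) c
     (in1 x b ∘ pr1 x a + in2 x b ∘ f ∘ pr2 x a) (g ∘ pr2 x b)
     (fmap S (in2 x a) ∘ h)).
Proof.
move=> R Cx; apply: prt_iso prt _ _ _ (prt_sum prt (RC_id Cx) R).
exists (idm _), (idm _), (pr2 (zob A) c); split; try exact: isiso1; last first.
  exists (in2 (zob A) c); rewrite pr2in2; split=> //.
  apply: bip_from; bip_simp=> //.
  by rewrite (hom_from0 (in1 _ _)) // zobP.
split=> /=; bip_simp=> //.
Qed.

Lemma monic_push (a b x : A) (i : Hom a x) (f : Hom a b) :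
  is_monic X i -> is_monic X (in1 x b ∘ i + in2 x b ∘ f).
Proof.
move=> mi y u Xy; have [v <-] := mi y u Xy.
by exists (v ∘ pr1 x b); bip_simp.
Qed.

Lemma monic_sum_idl (a b x : A) (f : Hom a b) :
  is_monic X f -> is_monic X (in1 x b ∘ pr1 x a + in2 x b ∘ f ∘ pr2 x a).
Proof.
move=> mf y u Xy; have [v vE] := mf y (u ∘ in2 x a) Xy.
exists (u ∘ in1 x a ∘ pr1 x b + v ∘ pr2 x b).
by apply: bip_from; bip_simp.
Qed.

Lemma monic_sum_idr (a b x : A) (f : Hom a b) :
  is_monic X f -> is_monic X (in1 b x ∘ f ∘ pr1 a x + in2 b x ∘ pr2 a x).
Proof.
move=> mf y u Xy; have [v vE] := mf y (u ∘ in1 a x) Xy.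
exists (v ∘ pr1 b x + u ∘ in2 a x ∘ pr2 b x).
by apply: bip_from; bip_simp.
Qed.

Lemma monic_split (a b : A) (f : Hom a b) (g : Hom b a) :
  g ∘ f = idm a -> is_monic X f.
Proof. by move=> gf y u _; exists (u ∘ g); rewrite -compA gf compm1. Qed.

Lemma RC_octahedron (a b c c' a' b' : A) (f : Hom a b) (g : Hom b c)
    (l : Hom b c') (m : Hom c' (S a)) (h : Hom c a') (j : Hom a' (S b))
    (u : Hom c b') (v : Hom b' (S a)) :
  C a -> C b -> C c -> is_monic X f -> is_monic X g ->
  RC (RSeq f l m) -> RC (RSeq g h j) -> RC (RSeq (g ∘ f) u v) ->
  exists r s, [/\ r ∘ l = u ∘ g, v ∘ r = m, s ∘ u = h & j ∘ s = fmap S f ∘ v] /\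
    (RC (RSeq r s (fmap S l ∘ j)) /\ is_monic X r).
Proof. by move=> Ca Cb Cc mf mg Rf Rg Rgf; exact: (prt4 prt) Rf Rg Rgf. Qed.

(* The octahedron on (1,f) : a -> a + b and i + 1 : a + b -> x + b. *)
Lemma RC_mapping_cone (a b x w : A) (i : Hom a x) (p : Hom x w) (q : Hom w (S a))
    (f : Hom a b) :
  RC (RSeq i p q) -> is_preenvelope X i -> C a -> C b ->
  exists (n : A) (u : Hom (bip x b) n) (v : Hom n (S a)) (s : Hom n w),
  [/\ C n, RC (RSeq (in1 x b ∘ i + in2 x b ∘ f) u v),
      s ∘ u = p ∘ pr1 x b /\ q ∘ s = v,
      RC (RSeq (- (u ∘ in2 x b)) s (fmap S f ∘ q)) &
      is_monic X (- (u ∘ in2 x b))].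
Proof.
move=> R env Ca Cb; have [Xx mi] := env.
have [n [u [v Rn]]] := prt1_push prt R Ca env f Cb.
have [Cn _ _] := prt_seq prt Rn.
have Cx : C x by apply: prt_sub prt _ Xx.
pose g := in1 x b ∘ i ∘ pr1 a b + in2 x b ∘ pr2 a b.
have gE : g ∘ (in1 a b + in2 a b ∘ f) = in1 x b ∘ i + in2 x b ∘ f.
  by rewrite /g; bip_simp.
have mf : is_monic X (in1 a b + in2 a b ∘ f).
  by apply: (@monic_split _ _ _ (pr1 a b)); bip_simp.
have Rn' : RC (RSeq (g ∘ (in1 a b + in2 a b ∘ f)) u v) by rewrite gE.
have [r [s [[e1 e2 e3 e4] [Rr mr]]]] := RC_octahedron Ca (insub_bip Ca Cb)
  (insub_bip Cx Cb) mf (monic_sum_idr mi) (prt1_graph prt f Ca Cb)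
  (RC_sum_idr R Cb) Rn'.
(* Restrict [r ∘ l = u ∘ g] to the summand [b], where [l = (f, -1)] is [-1]. *)
have rE : r = - (u ∘ in2 x b).
  have := congr1 (fun w => w ∘ in2 a b) e1.
  by rewrite /= /g; bip_simp => /(congr1 -%R); rewrite opprK.
exists n, u, v, s; rewrite -rE; split=> //.
- split=> //; have := congr1 (fun w => fmap S (pr1 a b) ∘ w) e4.
  by rewrite /= !compA -!fmapM; bip_simp.
- move: Rr; congr (RC (RSeq _ _ _)).
  by rewrite compA -fmapM; bip_simp.
Qed.

(** The map [r] becomes invertible modulo [X]. Ladders over [(de, 1)] and [pr2] give [r] and [k]
    with [k ∘ r] unipotent. The composite [r ∘ k] is unipotent only after adding a term through [x]:
    the map [pr1 - de ∘ pr2] kills [(i, f)], so it is some [s ∘ u], and [u ∘ in1 ∘ s] is the missing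
    term. *)
Lemma RC_cone_compare (a b c x n : A) (i : Hom a x) (f : Hom a b) (g : Hom b c)
    (h : Hom c (S a)) (de : Hom b x) (u : Hom (bip x b) n) (v : Hom n (S a)) :
  RC (RSeq f g h) -> RC (RSeq (in1 x b ∘ i + in2 x b ∘ f) u v) -> X x ->
  de ∘ f = i ->
  exists (r : Hom c n) (k k' : Hom n c),
  [/\ r ∘ g = u ∘ (in1 x b ∘ de + in2 x b), v ∘ r = h,
      k ∘ r = idm c & r ∘ k' - idm n \in factors X n n].
Proof.
move=> Rf Rn Xx deE.
have [|r [rg vr]] := RC_ladder (al := idm a) (be := in1 x b ∘ de + in2 x b) Rf Rn.
  by bip_simp; rewrite deE.
have [|k [ku hk]] := RC_ladder (al := idm a) (be := pr2 x b) Rn Rf.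
  by bip_simp.
rewrite fmap1 comp1m in vr; rewrite fmap1 comp1m in hk.
have [w [w1 w2]] : isiso (k ∘ r).
  apply: (RC_unipotent Rf); first by rewrite -compA rg compA ku; bip_simp.
  by rewrite compA hk.
have [|s sE] := RC_wcok1 (u := pr1 x b - de ∘ pr2 x b) Rn.
  by bip_simp; rewrite deE subrr.
have [m [m1 m2]] : isiso (r ∘ k + u ∘ in1 x b ∘ s).
  apply: (RC_unipotent Rn).
    rewrite compDl -!compA ku -sE compA rg.
    by apply: bip_from; bip_simp=> //; rewrite addrAC subrr add0r.
  rewrite compDr !compA vr hk.
  by have [_ ->] := RC_comp0 Rn; rewrite !comp0m addr0.
exists r, (w ∘ k), (k ∘ m); split=> //; first by rewrite -compA.
move: m2; rewrite compDl -!compA => <-.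
rewrite opprD addNKr rpredN.
by apply/factorsP; exists x, (s ∘ m), (u ∘ in1 x b); rewrite -!compA.
Qed.

End PartialRightTheory.

(** * The stable category of a partial right triangulated category *)

(* The stable category is replaced by any category T equipped with maps o on
   objects and cl on morphisms presenting it as C/X.  For A itself T is C/X; for
   the opposite category of A it is the opposite of the stable category, which
   is isomorphic, but not equal, to the stable category of the opposite. *)
Section StableModel.
Variables (A : addcat) (S : addfun A A) (C X : addsub A) (RC : rseq S -> Prop).
Hypothesis prt : partial_right_triangulated C X RC.
Variables (T : addcat) (o : T -> A).
Hypothesis oC : forall t, C (o t).
Hypothesis lift_ob : forall P : A -> Prop, (forall t, P (o t)) -> forall c, C c -> P c.
Variable cl : forall a b : T, Hom (o a) (o b) -> Hom a b.
Hypothesis cl_surj : forall (a b : T) (q : Hom a b), exists f, q = cl f.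
Hypothesis clD : forall (a b : T) (f g : Hom (o a) (o b)), cl (f + g) = cl f + cl g.
Hypothesis cl1 : forall a : T, @cl a a (idm (o a)) = idm a.
Hypothesis clM : forall (a b c : T) (g : Hom (o b) (o c)) (f : Hom (o a) (o b)),
  @cl a c (g ∘ f) = cl g ∘ cl f.
Hypothesis cl_eq0 : forall (a b : T) (f : Hom (o a) (o b)),
  cl f = 0 <-> f \in factors X (o a) (o b).
Variables (ST : addfun T T) (fX : T -> A).
Variables (fi : forall a : T, Hom (o a) (fX a)) (fp : forall a, Hom (fX a) (o (ST a)))
  (fq : forall a : T, Hom (o (ST a)) (S (o a))).
Hypothesis fRC : forall a, RC (RSeq (fi a) (fp a) (fq a)).
Hypothesis fenv : forall a, is_preenvelope X (fi a).
Hypothesis ST_cl : forall (a b : T) (f : Hom (o a) (o b))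
  (k : Hom (o (ST a)) (o (ST b))) (sg : Hom (fX a) (fX b)),
  sg ∘ fi a = fi b ∘ f -> k ∘ fp a = fp b ∘ sg -> fq b ∘ k = fmap S f ∘ fq a ->
  fmap ST (cl f) = cl k.

Lemma cl0 (a b : T) : @cl a b 0 = 0.
Proof. by apply/cl_eq0; rewrite rpred0. Qed.

Lemma clN (a b : T) (f : Hom (o a) (o b)) : cl (- f) = - cl f.
Proof. by apply: (addrI (cl f)); rewrite -clD !subrr cl0. Qed.

Lemma cl_eqP (a b : T) (f g : Hom (o a) (o b)) :
  cl f = cl g <-> f - g \in factors X (o a) (o b).
Proof.
rewrite -cl_eq0 clD clN; split=> [->|/eqP]; first by rewrite subrr.
by rewrite subr_eq0 => /eqP.
Qed.

Lemma isiso_cl (a b : T) (f : Hom (o a) (o b)) (l r : Hom (o b) (o a)) :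
  l ∘ f - idm _ \in factors X (o a) (o a) ->
  f ∘ r - idm _ \in factors X (o b) (o b) -> isiso (cl f).
Proof.
move=> /cl_eqP lf /cl_eqP fr.
by apply: (@isiso_linv_rinv _ _ _ _ (cl l) (cl r)); rewrite -clM ?lf ?fr cl1.
Qed.

Definition std (a b c : T) (f : Hom (o a) (o b)) (g : Hom (o b) (o c))
    (h : Hom (o c) (S (o a))) (de : Hom (o b) (fX a)) (xi : Hom (o c) (o (ST a))) :=
  [/\ RC (RSeq f g h) /\ is_monic X f, de ∘ f = fi a, xi ∘ g = fp a ∘ de &
      fq a ∘ xi = h].

Definition stdseq (s : rseq ST) : Prop :=
  exists (a b c : T) (f : Hom (o a) (o b)) (g : Hom (o b) (o c))
    (h : Hom (o c) (S (o a))) (de : Hom (o b) (fX a)) (xi : Hom (o c) (o (ST a))),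
    std f g h de xi /\ s = @RSeq T ST a b c (cl f) (cl g) (cl xi).

Definition model_Delta : rseq ST -> Prop := iso_closure stdseq.

Lemma model_Delta_std (a b c : T) (f : Hom (o a) (o b)) (g : Hom (o b) (o c))
    (h : Hom (o c) (S (o a))) de xi :
  std f g h de xi -> model_Delta (RSeq (cl f) (cl g) (cl xi)).
Proof.
move=> st; exists (RSeq (cl f) (cl g) (cl xi)); last exact: riso_refl.
by exists a, b, c, f, g, h, de, xi.
Qed.

Lemma model_Delta_iso (s t : rseq ST) : riso s t -> model_Delta s -> model_Delta t.
Proof. by move=> st [s0 ? i]; exists s0 => //; apply: riso_trans st. Qed.

Lemma in2pr2_factors (x b : A) :
  X x -> in2 x b ∘ pr2 x b - idm _ \in factors X (bip x b) (bip x b).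
Proof.
move=> Xx; rewrite -bipP opprD addrCA subrr addr0 rpredN.
by apply/factorsP; exists x, (pr1 x b), (in1 x b).
Qed.

Lemma std_ex (a b c : T) (f : Hom (o a) (o b)) (g : Hom (o b) (o c))
    (h : Hom (o c) (S (o a))) :
  RC (RSeq f g h) -> is_monic X f -> exists de xi, std f g h de xi.
Proof.
move=> R mf; have [Xx _] := fenv a.
have [de deE] := mf _ (fi a) Xx.
have [|xi [x1 x2]] := RC_ladder prt (al := idm _) (be := de) R (fRC a).
  by rewrite compm1.
by exists de, xi; split=> //; rewrite x2 fmap1 comp1m.
Qed.

(** If [k] represents the image of [al], then [k ∘ xi - xi' ∘ ga] is the third component over
    [sg ∘ de - de' ∘ be], a map that vanishes on [f]. By [RC_null] it factors through [X]. *)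
Lemma std_rmor (a b c a' b' c' : T)
    (f : Hom (o a) (o b)) (g : Hom (o b) (o c)) h de xi
    (f' : Hom (o a') (o b')) (g' : Hom (o b') (o c')) h' de' xi'
    (al : Hom (o a) (o a')) (be : Hom (o b) (o b')) (ga : Hom (o c) (o c')) :
  std f g h de xi -> std f' g' h' de' xi' ->
  be ∘ f = f' ∘ al -> ga ∘ g = g' ∘ be -> fmap S al ∘ h = h' ∘ ga ->
  fmap ST (cl al) ∘ cl xi = cl xi' ∘ cl ga.
Proof.
move=> [[R mf] d1 d2 d3] [[R' mf'] d1' d2' d3'] e1 e2 e3.
have [Xa mi] := fenv a; have [Xa' _] := fenv a'.
have [sg sgE] := mi _ (fi a' ∘ al) Xa'.
have [k [k1 k2]] := RC_ladder prt (fRC a) (fRC a') sgE.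
rewrite (ST_cl sgE k1 k2) -!clM; apply/cl_eqP.
apply: (RC_null prt (be := sg ∘ de - de' ∘ be) R (fRC a') Xa').
- by rewrite compBl -!compA d1 sgE e1 (compA de') d1' subrr.
- by rewrite compBl compBr -!compA d2 compA k1 e2 !compA d2' -!compA.
- by rewrite compBr !compA k2 d3' -e3 -compA d3 subrr.
Qed.

Lemma cone_std (a b n : T) (f : Hom (o a) (o b)) (u : Hom (bip (fX a) (o b)) (o n))
    (v : Hom (o n) (S (o a))) (s : Hom (o n) (o (ST a))) :
  RC (RSeq (in1 (fX a) (o b) ∘ fi a + in2 (fX a) (o b) ∘ f) u v) ->
  s ∘ u = fp a ∘ pr1 (fX a) (o b) -> fq a ∘ s = v ->
  model_Delta (@RSeq T ST a b n (cl f) (cl (u ∘ in2 (fX a) (o b))) (cl s)).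
Proof.
move=> R su qs; have [Xx mi] := fenv a.
have mp := @monic_push A X _ _ _ _ f mi.
(* The biproduct is replaced by an unspecified object carrying the same injections and projections,
   because [lift_ob] can substitute some [o t] only for a generalized object. *)
have: exists (b1 : A) (i1 : Hom (fX a) b1) (i2 : Hom (o b) b1) (p1 : Hom b1 (fX a))
    (p2 : Hom b1 (o b)) (u1 : Hom b1 (o n)), C b1 /\ RC (RSeq (i1 ∘ fi a + i2 ∘ f) u1 v) /\
    is_monic X (i1 ∘ fi a + i2 ∘ f) /\
    [/\ p1 ∘ i1 = idm _, p2 ∘ i2 = idm _, p1 ∘ i2 = 0, p2 ∘ i1 = 0 &
      i1 ∘ p1 + i2 ∘ p2 = idm _] /\ s ∘ u1 = fp a ∘ p1 /\ u ∘ in2 _ _ = u1 ∘ i2.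
  exists _, (in1 _ _), (in2 _ _), (pr1 _ _), (pr2 _ _), u; split.
    exact: insub_bip (prt_sub prt Xx) (oC b).
  do 4!split=> //;
    first [exact: pr1in1 | exact: pr2in2 | exact: pr1in2 | exact: pr2in1 | exact: bipP].
case=> b1 [i1 [i2 [p1 [p2 [u1 [Cb1 H]]]]]].
move: b1 Cb1 i1 i2 p1 p2 u1 H; apply: lift_ob => b1 i1 i2 p1 p2 u1.
move=> [R1 [m1 [[e1 e2 e3 e4 e5] [su1 ->]]]].
have st : std (i1 ∘ fi a + i2 ∘ f) u1 v p1 s.
  by split=> //; rewrite compDr !compA e1 e3 comp1m comp0m addr0.
apply: model_Delta_iso (model_Delta_std st).
exists (idm a), (cl p2), (idm n); split; try exact: isiso1.
- split=> /=.
  + by rewrite -clM compm1 compDr !compA e4 e2 comp0m comp1m add0r.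
  + rewrite comp1m -clM; apply/cl_eqP.
    rewrite -[X in X - _]compm1 -e5 compDr -!compA addrK.
    by apply/factorsP; exists (fX a), p1, (u1 ∘ i1); rewrite -compA.
  + by rewrite fmap1 compm1 comp1m.
- apply: (@isiso_cl _ _ p2 i2 i2); last by rewrite e2 subrr rpred0.
  rewrite -e5 opprD addrCA subrr addr0 rpredN.
  by apply/factorsP; exists (fX a), p1, i1.
Qed.

Lemma cone_ex (a b : T) (f : Hom (o a) (o b)) :
  exists (n : T) (u : Hom (bip (fX a) (o b)) (o n)) (v : Hom (o n) (S (o a)))
    (s : Hom (o n) (o (ST a))),
  [/\ RC (RSeq (in1 (fX a) (o b) ∘ fi a + in2 (fX a) (o b) ∘ f) u v),
      s ∘ u = fp a ∘ pr1 (fX a) (o b), fq a ∘ s = v,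
      RC (RSeq (- (u ∘ in2 (fX a) (o b))) s (fmap S f ∘ fq a)) &
      is_monic X (- (u ∘ in2 (fX a) (o b)))].
Proof.
have [n [u [v [s [Cn R [e1 e2] R' m]]]]] :=
  RC_mapping_cone prt f (fRC a) (fenv a) (oC a) (oC b).
move: n Cn u v s R e1 e2 R' m; apply: lift_ob => n u v s R e1 e2 R' m.
by exists n, u, v, s.
Qed.

(** The last row of the octahedron behind the cone is itself standard; its connecting map [ze] has
    the class of [fmap ST (cl f)], since a representative [k] of the latter and [ze] agree on [fp a]
    and after [fq b]. The automorphisms [1, -1, -1] then move the sign from the first map to the
    last. *)
Lemma cone_rot (a b n : T) (f : Hom (o a) (o b)) (u : Hom (bip (fX a) (o b)) (o n))
    (v : Hom (o n) (S (o a))) (s : Hom (o n) (o (ST a))) :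
  RC (RSeq (in1 (fX a) (o b) ∘ fi a + in2 (fX a) (o b) ∘ f) u v) ->
  s ∘ u = fp a ∘ pr1 (fX a) (o b) -> fq a ∘ s = v ->
  RC (RSeq (- (u ∘ in2 (fX a) (o b))) s (fmap S f ∘ fq a)) ->
  is_monic X (- (u ∘ in2 (fX a) (o b))) ->
  model_Delta (@RSeq T ST b n (ST a) (cl (u ∘ in2 (fX a) (o b))) (cl s)
    (- fmap ST (cl f))).
Proof.
move=> R su qs R' m'; have [Xx mi] := fenv a; have [Xb _] := fenv b.
have [sg sgE] := mi _ (fi b ∘ f) Xb.
have [k [k1 k2]] := RC_ladder prt (fRC a) (fRC b) sgE.
(* The map [(sg, - fi b)] kills [(fi a, f)]; its factor [de] through [u] is the map to the
   preenvelope that makes the rotated row standard. *)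
have [|de deE] := RC_wcok1 prt (u := sg ∘ pr1 _ _ - fi b ∘ pr2 _ _) R.
  by bip_simp; rewrite sgE subrr.
have de2 : de ∘ (- (u ∘ in2 (fX a) (o b))) = fi b ∘ idm (o b).
  by rewrite compmN compA -deE; bip_simp.
have [ze [z1 z2]] := RC_ladder prt R' (fRC b) de2.
rewrite fmap1 comp1m in z2; rewrite compm1 in de2.
have st : std (- (u ∘ in2 (fX a) (o b))) s (fmap S f ∘ fq a) de ze by [].
have zE : fmap ST (cl f) = cl ze.
  rewrite (ST_cl sgE k1 k2); apply/cl_eqP.
  apply: (RC_null prt (be := 0) (fRC a) (fRC b) Xb); first exact: comp0m.
    rewrite compm0 compBl k1.
    have -> : fp a = s ∘ u ∘ in1 (fX a) (o b) by rewrite su; bip_simp.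
    rewrite !compA z1 -[fp b ∘ de ∘ u]compA -deE; bip_simp.
    by rewrite subrr.
  by rewrite compBr k2 z2 subrr.
rewrite zE; apply: model_Delta_iso (model_Delta_std st).
exists (idm b), (- idm n), (- idm (ST a)); split; try exact: isiso1.
- by split=> /=; rewrite ?clN ?fmap1; bip_simp.
- exact: isisoN (isiso1 _).
- exact: isisoN (isiso1 _).
Qed.

Lemma std_cone_riso (a b c n : T) (f : Hom (o a) (o b)) (g : Hom (o b) (o c)) h de xi
    (u : Hom (bip (fX a) (o b)) (o n))
    (v : Hom (o n) (S (o a))) (s : Hom (o n) (o (ST a))) :
  std f g h de xi ->
  RC (RSeq (in1 (fX a) (o b) ∘ fi a + in2 (fX a) (o b) ∘ f) u v) ->
  s ∘ u = fp a ∘ pr1 (fX a) (o b) -> fq a ∘ s = v ->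
  riso (@RSeq T ST a b c (cl f) (cl g) (cl xi))
       (RSeq (cl f) (cl (u ∘ in2 (fX a) (o b))) (cl s)).
Proof.
move=> [[Rf mf] deE xg qx] R su qs; have [Xx _] := fenv a.
have [r [k [k' [rg vr kr rk]]]] := RC_cone_compare prt Rf R Xx deE.
have ri : isiso (cl r) by apply: (@isiso_cl _ _ r k k'); rewrite // kr subrr rpred0.
refine (@riso_same_ends _ _ _ _ _ _ _ _ _ _ _ (cl r) ri _ _).
  rewrite -clM; apply/cl_eqP; rewrite rg compDr addrK.
  by apply/factorsP; exists (fX a), de, (u ∘ in1 _ _); rewrite -compA.
rewrite -clM; apply/cl_eqP; apply: (RC_null prt (be := 0) Rf (fRC a) Xx).
- exact: comp0m.
- by rewrite compBl xg -!compA rg compA su; bip_simp; rewrite subrr.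
- by rewrite compBr qx compA qs vr subrr.
Qed.

Lemma model_Delta_id (a : T) : model_Delta (@RSeq T ST (zob T) a a 0 (idm a) 0).
Proof.
(* Nothing relates [o (zob T)] to [zob A], so a preimage [z] of the latter serves and is compared
   with [zob T] afterwards. *)
have [z [z0 R]] : exists z : T, idm (o z) = 0 /\ RC (@RSeq A S (o z) (o a) (o a) 0 (idm _) 0).
  have := RC_0id prt (oC a); have := zobP A; have := insub0 C.
  by move: (zob A); apply: lift_ob => z z0 R; exists z.
have st : @std z a a 0 (idm _) 0 0 0.
  split; rewrite ?comp0m ?compm0 //; last by rewrite (hom_from0 (fi z)).
  by split=> // x u _; exists 0; rewrite comp0m (hom_from0 u).
apply: model_Delta_iso (model_Delta_std st).
have zT (w w' : T) (e : Hom w w') : idm w = 0 -> idm w' = 0 -> isiso e.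
  by move=> w0 w0'; exists 0; rewrite comp0m compm0 w0 w0'.
exists 0, (idm a), (idm a); split; [split | | exact: isiso1 | exact: isiso1];
  rewrite /= ?cl1 ?cl0 ?fmap0; bip_simp => //.
by apply: zT; [rewrite -cl1 z0 cl0 | exact: zobP].
Qed.

Lemma model_Delta_ladder : ladder_completion model_Delta.
Proof.
apply: ladder_iso_closure => s t al be Ds Dt; move: Ds Dt al be.
case=> a [b [c [f [g [h [de [xi [st ->]]]]]]]].
case=> a' [b' [c' [f' [g' [h' [de' [xi' [st' ->]]]]]]]] /= al be.
have [al0 ->] := cl_surj al; have [be0 ->] := cl_surj be.
rewrite -!clM => /cl_eqP /factorsP[x [w [w' [Xx E]]]].
have [[R mf] _ _ _] := st; have [[R' _] _ _ _] := st'.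
have [y yE] := mf _ w Xx.
have sq : (be0 - w' ∘ y) ∘ f = f' ∘ al0.
  by rewrite compBl -compA yE -E opprB addrCA subrr addr0.
have [ga [ga1 ga2]] := RC_ladder prt R R' sq.
have -> : cl be0 = cl (be0 - w' ∘ y).
  by apply/cl_eqP; rewrite opprB addrCA subrr addr0; apply/factorsP; exists x, y, w'.
exists (cl ga); split=> /=; rewrite -?clM ?sq ?ga1 //.
by rewrite (std_rmor st st' sq ga1 (esym ga2)) clM.
Qed.

Lemma model_Delta_rot s : model_Delta s -> model_Delta (rot s).
Proof.
case=> s0 [a [b [c [f [g [h [de [xi [st ->]]]]]]]]] i.
apply: (model_Delta_iso (riso_rot i)).
have [n [u [v [k [R ku qk R' m']]]]] := cone_ex f.
apply: model_Delta_iso (cone_rot R ku qk R' m').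
exact: riso_rot (riso_sym (std_cone_riso st R ku qk)).
Qed.

(** The composite of the two chosen monics is again of cone form, with [g2 ∘ f] in place of [f], so
    a triangle over it is available. The objects are left unspecified in the statement so that
    [lift_ob] applies to all of them. *)
Lemma cone_octahedron (a b c : T) (f : Hom (o a) (o b)) (g : Hom (o b) (o c)) :
  exists (b1 c1 c' a' b' : A) (be : Hom (o b) b1) (be' : Hom b1 (o b))
    (ga : Hom (o c) c1) (ga' : Hom c1 (o c)) (f1 : Hom (o a) b1) (g1 : Hom b1 c1)
    (l : Hom b1 c') (m : Hom c' (S (o a))) (h : Hom c1 a') (j : Hom a' (S b1))
    (u : Hom c1 b') (v : Hom b' (S (o a))) (r : Hom c' b') (s : Hom b' a'),
  [/\ [/\ C b1, C c1, C c', C a' & C b'],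
      [/\ be' ∘ be = idm _, be ∘ be' - idm _ \in factors X _ _,
          ga' ∘ ga = idm _ & ga ∘ ga' - idm _ \in factors X _ _],
      f1 - be ∘ f \in factors X _ _ /\ g1 ∘ be - ga ∘ g \in factors X _ _,
      [/\ RC (RSeq f1 l m) /\ is_monic X f1, RC (RSeq g1 h j) /\ is_monic X g1,
          RC (RSeq (g1 ∘ f1) u v) /\ is_monic X (g1 ∘ f1) &
          RC (RSeq r s (fmap S l ∘ j)) /\ is_monic X r] &
      [/\ r ∘ l = u ∘ g1, v ∘ r = m, s ∘ u = h & j ∘ s = fmap S f1 ∘ v]].
Proof.
have [Xa mia] := fenv a; have [Xb mib] := fenv b.
pose g2 := in1 (fX b) (o c) ∘ fi b + in2 (fX b) (o c) ∘ g.
have Cc2 : C (bip (fX b) (o c)) := insub_bip (prt_sub prt Xb) (oC c).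
have Cb1 : C (bip (fX a) (o b)) := insub_bip (prt_sub prt Xa) (oC b).
have Cc1 := insub_bip (prt_sub prt Xa) Cc2.
have [c' [l [m [_ [Cc' Rf _ _ _]]]]] := RC_mapping_cone prt f (fRC a) (fenv a) (oC a) (oC b).
have [a' [h [j [_ [Ca' Rg _ _ _]]]]] := RC_mapping_cone prt g (fRC b) (fenv b) (oC b) (oC c).
have [b' [u [v [_ [Cb' Rgf _ _ _]]]]] :=
  RC_mapping_cone prt (g2 ∘ f) (fRC a) (fenv a) (oC a) Cc2.
have R1 := RC_sum_idl prt Rg (prt_sub prt Xa).
have mf := @monic_push A X _ _ _ _ f mia.
have mg := @monic_sum_idl A X _ _ (fX a) _ (@monic_push A X _ _ _ _ g mib).
have mgf := @monic_push A X _ _ _ _ (g2 ∘ f) mia.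
set f1 := in1 _ _ ∘ fi a + _ in Rf mf; rewrite -/g2 in mg R1.
set g1 := in1 _ _ ∘ pr1 _ _ + _ in R1 mg.
have gfE : in1 _ _ ∘ fi a + in2 _ _ ∘ (g2 ∘ f) = g1 ∘ f1.
  by rewrite /g1 /f1; bip_simp.
rewrite gfE in Rgf mgf.
have [r [s [e [Rr mr]]]] := RC_octahedron prt (oC a) Cb1 Cc1 mf mg Rf R1 Rgf.
exists (bip (fX a) (o b)), (bip (fX a) (bip (fX b) (o c))), c', a', b', (in2 _ _),
  (pr2 _ _), (in2 _ _ ∘ in2 _ _), (pr2 _ _ ∘ pr2 _ _).
exists f1, g1, l, m, (h ∘ pr2 _ _), (fmap S (in2 _ _) ∘ j), u, v, r, s.
split=> //.
- split; first exact: pr2in2.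
  + exact: in2pr2_factors.
  + by bip_simp.
  + set k := in2 (fX b) (o c) ∘ pr2 (fX b) (o c) - idm _.
    have -> : in2 (fX a) _ ∘ in2 (fX b) (o c) ∘ (pr2 (fX b) (o c) ∘ pr2 (fX a) _) - idm _
      = in2 _ _ ∘ k ∘ pr2 _ _ + (in2 (fX a) _ ∘ pr2 (fX a) _ - idm _).
      by rewrite /k; bip_simp; rewrite addrA subrK.
    apply: rpredD; last exact: in2pr2_factors.
    by apply: factors_precomp; apply: factors_postcomp; exact: in2pr2_factors.
- split.
    by rewrite addrK; apply/factorsP; exists (fX a), (fi a), (in1 _ _).
  have -> : g1 ∘ in2 _ _ - in2 (fX a) _ ∘ in2 (fX b) (o c) ∘ g = in2 _ _ ∘ in1 _ _ ∘ fi b.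
    by rewrite /g1 /g2; bip_simp; rewrite addrK.
  by apply/factorsP; exists (fX b), (fi b), (in2 _ _ ∘ in1 _ _).
Qed.

Lemma model_Delta_octahedron : octahedron_upto_iso model_Delta.
Proof.
move=> a b c q p; have [f ->] := cl_surj q; have [g ->] := cl_surj p.
have [b1 [c1 [c' [a' [b' H]]]]] := cone_octahedron f g.
have [be [be' [ga [ga' [f1 [g1 [l [m [h [j [u [v [r [s [Cs K]]]]]]]]]]]]]]] := H.
case: Cs => Cb1 Cc1 Cc' Ca' Cb'.
move: b1 Cb1 c1 Cc1 c' Cc' a' Ca' b' Cb' be be' ga ga' f1 g1 l m h j u v r s K {H}.
apply: lift_ob => b1; apply: lift_ob => c1; apply: lift_ob => c'.
apply: lift_ob => a'; apply: lift_ob => b' be be' ga ga' f1 g1 l m h j u v r s.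
move=> [[bb bb' gg gg'] [fE gE] [[Rf mf] [Rg mg] [Rgf mgf] [Rr mr]] [e1 e2 e3 e4]].
have [d1 [x1 st1]] := std_ex Rf mf; have [d2 [x2 st2]] := std_ex Rg mg.
have [d3 [x3 st3]] := std_ex Rgf mgf; have [d4 [x4 st4]] := std_ex Rr mr.
exists b1, c1, (cl be), (cl ga), (cl g1), c', a', b', (cl l), (cl x1), (cl h), (cl x2),
  (cl u), (cl x3), (cl r), (cl s).
have cE : cl be ∘ cl f = cl f1 by rewrite -clM; apply/esym/cl_eqP.
(* The ladders [(1, g1, r)], [(f1, 1, s)] and [(l, u, 1)] of the octahedron in [A]. The last one
   identifies the connecting map of the fourth triangle. *)
have m1 := std_rmor (al := idm _) (be := g1) st1 st3; rewrite cl1 !fmap1 in m1.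
have m2 := std_rmor (al := f1) (be := idm _) st3 st2; rewrite !compm1 !comp1m in m2.
have m3 := std_rmor (al := l) (be := u) (ga := idm _) st2 st4.
rewrite cl1 !compm1 !comp1m in m3.
rewrite cE; split; [split | split; [split | split; [split | ]]].
- by apply: (@isiso_cl _ _ be be' be'); rewrite // bb subrr rpred0.
- by apply: (@isiso_cl _ _ ga ga' ga'); rewrite // gg subrr rpred0.
- by rewrite -!clM; apply/cl_eqP.
- exact: model_Delta_std st1.
- exact: model_Delta_std st2.
- by rewrite -clM; exact: model_Delta_std st3.
- by rewrite -!clM e1.
- by rewrite -m1 ?comp1m ?compm1.
- by rewrite -clM e3.
- by rewrite -m2.
- by rewrite m3 //; exact: model_Delta_std st4.
Qed.

Theorem model_right_triangulated : right_triangulated model_Delta.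
Proof.
apply: right_triangulated_of_upto_iso.
- exact: model_Delta_iso.
- exact: model_Delta_id.
- exact: model_Delta_rot.
- exact: model_Delta_ladder.
- move=> a b q; have [f ->] := cl_surj q.
  have [n [u [v [s [R su qs _ _]]]]] := cone_ex f.
  by exists n, (cl (u ∘ in2 _ _)), (cl s); exact: cone_std R su qs.
- exact: model_Delta_octahedron.
Qed.

End StableModel.

(** * Descent along a reflection *)

Section Reflection.
Variables (T G : addcat) (S : addfun T T) (D : rseq S -> Prop).
Hypothesis rtD : right_triangulated D.
Variables (E : addfun G T) (R : addfun T G) (j : forall a : T, Hom a (E (R a))).
Hypothesis E_inj : forall (a b : G) (p q : Hom a b), fmap E p = fmap E q -> p = q.
Hypothesis j_nat : forall (a b : T) (f : Hom a b),
  fmap E (fmap R f) ∘ j a = j b ∘ f.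
Hypothesis j_ex : forall (a : T) (b : G) (y : Hom a (E b)),
  exists y', fmap E y' ∘ j a = y.
Hypothesis j_inj : forall (a : T) (b : G) (y : Hom (R a) b),
  fmap E y ∘ j a = 0 -> y = 0.
Variable jG : forall b : G, Hom b (R (E b)).
Hypothesis jGE : forall b, fmap E (jG b) = j (E b).
(* In the two instances w is an identity: SG and R S E agree on objects and
   morphisms, but their functoriality proofs are not convertible. *)
Variables (SG : addfun G G) (w : forall a : G, Hom (R (S (E a))) (SG a)).
Hypothesis w_iso : forall a, isiso (w a).
Hypothesis w_nat : forall (a b : G) (f : Hom a b),
  fmap SG f ∘ w a = w b ∘ fmap R (fmap S (fmap E f)).

Hypothesis stab : forall (a b c d : T) (f : Hom a b) (g : Hom b c) (h : Hom c (S a))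
    (k : Hom (E (R b)) d) (l : Hom d (S (E (R a)))),
    D (RSeq f g h) -> D (RSeq (fmap E (fmap R f)) k l) ->
    exists t : Hom c d,
      rmor (s := RSeq f g h) (t := RSeq (fmap E (fmap R f)) k l) (j a) (j b) t /\
      isiso (fmap R t).

Lemma j_eq (a : T) (b : G) (y z : Hom (R a) b) :
  fmap E y ∘ j a = fmap E z ∘ j a -> y = z.
Proof.
move=> e; apply/eqP; rewrite -subr_eq0; apply/eqP/j_inj.
by rewrite fmapD fmapN compBl e subrr.
Qed.

(** The inverse extends the identity of [E b] along [j (E b)]; it is two-sided because maps out of
    [R (E b)] are determined by their composite with [j]. *)
Lemma jG_iso (b : G) : isiso (jG b).
Proof.
have [y yE] := j_ex (idm (E b)); exists y; split.
  by apply: E_inj; rewrite fmapM jGE yE fmap1.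
by apply: j_eq; rewrite fmapM -compA yE fmap1 compm1 comp1m jGE.
Qed.

Lemma jG_nat (a b : G) (f : Hom a b) : fmap R (fmap E f) ∘ jG a = jG b ∘ f.
Proof. by apply: E_inj; rewrite !fmapM !jGE j_nat. Qed.

Lemma R_j (a : T) : fmap R (j a) = jG (R a).
Proof. by apply: j_eq; rewrite j_nat jGE. Qed.

Definition refl_seq (s : rseq SG) : Prop :=
  exists (a b : G) (c : T) (f : Hom a b) (g : Hom (E b) c) (h : Hom c (S (E a))),
    D (RSeq (fmap E f) g h) /\
    s = @RSeq G SG a b (R c) f (fmap R g ∘ jG b) (w a ∘ fmap R h).

Definition refl_Delta : rseq SG -> Prop := iso_closure refl_seq.

Lemma refl_Delta_iso (s t : rseq SG) : riso s t -> refl_Delta s -> refl_Delta t.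
Proof. by move=> st [s0 ? i]; exists s0 => //; apply: riso_trans st. Qed.

Lemma refl_DeltaI (a b : G) (c : T) (f : Hom a b) (g : Hom (E b) c)
    (h : Hom c (S (E a))) :
  D (RSeq (fmap E f) g h) ->
  refl_Delta (@RSeq G SG a b (R c) f (fmap R g ∘ jG b) (w a ∘ fmap R h)).
Proof.
move=> Df; exists (@RSeq G SG a b (R c) f (fmap R g ∘ jG b) (w a ∘ fmap R h)).
  by exists a, b, c, f, g, h.
exact: riso_refl.
Qed.

(* The stabilizing condition lets the triangle over E (R f) be traded for the one
   over f. *)
Lemma refl_Delta_R (a b c : T) (f : Hom a b) (g : Hom b c) (h : Hom c (S a)) :
  D (RSeq f g h) ->
  refl_Delta (@RSeq G SG (R a) (R b) (R c) (fmap R f) (fmap R g)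
    (w (R a) ∘ fmap R (fmap S (j a) ∘ h))).
Proof.
move=> Df; have [d [k [l Dd]]] := rt1_ex rtD (fmap E (fmap R f)).
have [t [[_ /= t2 t3] ti]] := stab Df Dd.
apply: refl_Delta_iso (refl_DeltaI Dd); apply: riso_sym.
refine (@riso_same_ends G SG _ _ _ _ _ _ _ _ _ (fmap R t) ti _ _).
  by rewrite -R_j -!fmapM t2.
by rewrite t3 fmapM compA.
Qed.

Lemma refl_Delta_id (a : G) : refl_Delta (@RSeq G SG (zob G) a a 0 (idm a) 0).
Proof.
have zE : idm (E (zob G)) = 0 by rewrite -fmap1 zobP fmap0.
have D1 : D (RSeq (fmap E (0 : Hom (zob G) a)) (idm (E a)) 0).
  apply: rt_iso rtD _ _ _ (rt1_id rtD (E a)).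
  exists 0, (idm _), (idm _); split; try exact: isiso1.
    by split; rewrite /= ?fmap0; bip_simp.
  by exists 0; rewrite comp0m compm0 zE zobP.
apply: refl_Delta_iso (refl_DeltaI D1).
have [y [y1 y2]] := jG_iso a.
refine (@riso_same_ends G SG _ _ _ _ _ _ _ _ _ y _ _ _).
- by exists (jG a).
- by rewrite fmap1 comp1m.
- by rewrite fmap0 compm0 comp0m.
Qed.

(** The rotation in [T] starts with [g], which is not in the image of [E], so [refl_Delta_R] is
    needed. It yields a triangle starting at [R (E b)], brought back to [b] by the inverse of
    [jG b]. *)
Lemma refl_Delta_rot s : refl_Delta s -> refl_Delta (rot s).
Proof.
case=> s0 [a [b [c [f [g [h [Df ->]]]]]]] i; apply: (refl_Delta_iso (riso_rot i)).
have [y [y1 y2]] := jG_iso b.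
apply: refl_Delta_iso (refl_Delta_R (rt2 rtD Df)).
exists y, (idm _), (w a); split; [split | by exists (jG b) | exact: isiso1 | exact: w_iso].
- by rewrite /= comp1m -compA y2 compm1.
- by rewrite /= compm1.
- rewrite /= compA w_nat -compA -fmapM compA -jGE -!fmapM y1 !fmap1 comp1m fmapN.
  by rewrite compmN -w_nat compNm.
Qed.

Lemma refl_Delta_ladder : ladder_completion refl_Delta.
Proof.
apply: ladder_iso_closure => s t al be Ds Dt; move: Ds Dt al be.
case=> a [b [c [f [g [h [Df ->]]]]]] [a' [b' [c' [f' [g' [h' [Df' ->]]]]]]] /= al be sq.
have [|ga [_ /= e2 e3]] := @rt3 _ _ _ rtD (RSeq (fmap E f) g h)
  (RSeq (fmap E f') g' h') (fmap E al) (fmap E be) Df Df'.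
  by rewrite /= -!fmapM sq.
exists (fmap R ga); split=> //=.
- by rewrite -!compA -jG_nat !compA -!fmapM e2.
- by rewrite compA w_nat -!compA -!fmapM e3.
Qed.

Lemma refl_Delta_octahedron : octahedron_upto_iso refl_Delta.
Proof.
move=> a b c f g.
have [c' [l [m Df]]] := rt1_ex rtD (fmap E f).
have [a' [h [k Dg]]] := rt1_ex rtD (fmap E g).
have [b' [u [v Dgf]]] := rt1_ex rtD (fmap E (g ∘ f)).
have Dgf' := Dgf; rewrite fmapM in Dgf'.
have [r [s [[e1 e2 e3 e4] [Dr _]]]] := rt4 rtD I I Df Dg Dgf'.
exists b, c, (idm b), (idm c), g, (R c'), (R a'), (R b').
exists (fmap R l ∘ jG b), (w a ∘ fmap R m), (fmap R h ∘ jG c), (w b ∘ fmap R k).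
exists (fmap R u ∘ jG c), (w a ∘ fmap R v), (fmap R r), (fmap R s).
rewrite !comp1m; split; [split | split; [split | split; [split |]]].
- exact: isiso1.
- exact: isiso1.
- by rewrite compm1.
- exact: refl_DeltaI.
- exact: refl_DeltaI.
- exact: refl_DeltaI.
- by rewrite compA -fmapM e1 fmapM -!compA jG_nat.
- by rewrite -compA -fmapM e2.
- by rewrite compA -fmapM e3.
- by rewrite -compA -fmapM e4 fmapM !compA w_nat.
(* The last row starts with [R r], where [r] is a map of [T] between third terms; the stabilizing
   condition enters here. *)
- have := refl_Delta_R Dr; congr (refl_Delta (RSeq _ _ _)).
  rewrite [RHS]compA w_nat [fmap E (_ ∘ jG b)]fmapM jGE j_nat -[RHS]compA -fmapM.
  by rewrite [fmap S (j _ ∘ l)]fmapM compA.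
Qed.

Theorem refl_right_triangulated : right_triangulated refl_Delta.
Proof.
apply: right_triangulated_of_upto_iso.
- exact: refl_Delta_iso.
- exact: refl_Delta_id.
- exact: refl_Delta_rot.
- exact: refl_Delta_ladder.
- move=> a b f; have [c [g [h Df]]] := rt1_ex rtD (fmap E f).
  by exists (R c), (fmap R g ∘ jG b), (w a ∘ fmap R h); exact: refl_DeltaI.
- exact: refl_Delta_octahedron.
Qed.

End Reflection.

Lemma right_triangulated_ext (T : addcat) (S : addfun T T) (D D' : rseq S -> Prop) :
  (forall s, D s <-> D' s) -> right_triangulated D -> right_triangulated D'.
Proof. by move=> DD'; have -> : D = D' by apply/funext => s; apply/propext. Qed.

(** * The right triangulations of [C/X] and [G/X] *)

Section StableCls.
Variables (A : addcat) (P X : addsub A).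

Lemma scls1 (a : objs P) : @scls A P X a a (idm (oval a)) = idm (a : stable P X).
Proof. by []. Qed.

Lemma scls_eq0 (a b : objs P) (f : @Hom A a b) :
  scls X f = 0 <-> f \in factors X (oval a) (oval b).
Proof.
have -> : 0 = scls X (0 : @Hom A a b) by rewrite /scls cls0.
by rewrite /scls cls_eq subr0.
Qed.

Lemma objs_ind (Q : A -> Prop) : (forall t : objs P, Q (oval t)) -> forall c, P c -> Q c.
Proof. by move=> H c Pc; exact: (H (InSub Pc)). Qed.

End StableCls.

Section Right.
Variables (A : addcat) (S : addfun A A) (C X : addsub A) (RC : rseq S -> Prop).
Hypothesis prt : partial_right_triangulated C X RC.
Variable fx : rfixed C X RC.

Lemma SigmaX_cls (a b : objs C) (f : @Hom A a b) (k : Hom (rU fx a) (rU fx b))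
    (sg : Hom (rX fx a) (rX fx b)) :
  sg ∘ ri fx a = ri fx b ∘ f -> k ∘ rp fx a = rp fx b ∘ sg ->
  rq fx b ∘ k = fmap S f ∘ rq fx a ->
  fmap (SigmaX prt fx) (scls X f) = @scls A C X (SigmaX_ob prt fx a) (SigmaX_ob prt fx b) k.
Proof. by move=> e1 e2 e3; apply: indmapE; exists sg. Qed.

Lemma DeltaX_model (s : rseq (SigmaX prt fx)) :
  @model_Delta A S X RC (stable C X) (@oval A C) (@scls A C X) (SigmaX prt fx)
    (rX fx) (ri fx) (rp fx) (rq fx) s
  <-> DeltaX s.
Proof.
split.
  case=> s0 [a [b [c [f [g [h [de [xi [[R e1 e2 e3] ->]]]]]]]]] i.
  by exists a, b, c, f, g, h, de, xi.
case=> a [b [c [f [g [h [de [xi [R e1 e2 e3 i]]]]]]]].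
exists (@RSeq (stable C X) (SigmaX prt fx) a b c (scls X f) (scls X g) (scls X xi)) => //.
by exists a, b, c, f, g, h, de, xi.
Qed.

Theorem DeltaX_right_triangulated : right_triangulated (@DeltaX A S C X RC prt fx).
Proof.
apply: (right_triangulated_ext DeltaX_model).
apply: (@model_right_triangulated A S C X RC prt (stable C X) (@oval A C)).
- exact: ovalP.
- exact: objs_ind.
- exact: scls_surj.
- exact: sclsD.
- exact: scls1.
- exact: sclsM.
- exact: scls_eq0.
- exact: rfixed_tri.
- exact: rfixed_env.
- exact: SigmaX_cls.
Qed.

(** Unlike RT1, this keeps the two rows in [RC] that lie behind the stable triangle and its
    rotation; the gluing argument applies (c), (d) and (e) to them. *)
Lemma DeltaX_cone (a b : objs C) (f : @Hom A a b) :
  let f1 := in1 (rX fx a) (oval b) ∘ ri fx a + in2 (rX fx a) (oval b) ∘ f in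
  exists (n : objs C) (u : Hom (bip (rX fx a) (oval b)) (oval n))
    (v : Hom (oval n) (S (oval a))) (s : @Hom A n (SigmaX_ob prt fx a)),
  [/\ RC (RSeq f1 u v) /\ is_monic X f1,
      s ∘ u = rp fx a ∘ pr1 (rX fx a) (oval b), rq fx a ∘ s = v,
      RC (RSeq (- (u ∘ in2 (rX fx a) (oval b))) s (fmap S f ∘ rq fx a)) /\
        is_monic X (- (u ∘ in2 (rX fx a) (oval b))) &
      DeltaX (@RSeq (stable C X) (SigmaX prt fx) a b n (scls X f)
        (@scls A C X b n (u ∘ in2 (rX fx a) (oval b))) (scls X s))].
Proof.
have [n [u [v [s [Cn R [e1 e2] R' m']]]]] :=
  RC_mapping_cone prt f (rfixed_tri fx a) (rfixed_env fx a) (ovalP a) (ovalP b).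
exists (InSub Cn), u, v, s; split=> //.
  by split=> //; apply: monic_push; case: (rfixed_env fx a).
apply/DeltaX_model.
refine (@cone_std A S C X RC prt (stable C X) (@oval A C) _ _ (@scls A C X) _ _ _ _
  (SigmaX prt fx) (rX fx) _ _ _ _ a b (InSub Cn) f u v s R e1 e2).
- exact: ovalP.
- exact: objs_ind.
- exact: sclsD.
- exact: scls1.
- exact: sclsM.
- exact: scls_eq0.
- exact: rfixed_env.
Qed.

Variables (G : addsub A) (sp : special_preenveloping C X RC G).

Lemma jcls_nat (a b : stable C X) (f : Hom a b) :
  fmap (EC sp) (fmap (RF prt sp) f) ∘ jcls prt sp a = jcls prt sp b ∘ f.
Proof.
have [f0 ->] := scls_surj f.
have [_ mi] := sp_env sp a; have [Gb _] := sp_env sp b.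
have [f' f'E] := mi _ (spj sp b ∘ f0) Gb.
rewrite /RF /= (indmapE (r := R_rel prt sp) (f' := f')) //.
by rewrite -[LHS]clsM f'E -[RHS]clsM.
Qed.

Lemma jcls_ex (a : stable C X) (b : stable G X) (y : Hom a (EC sp b)) :
  exists y', fmap (EC sp) y' ∘ jcls prt sp a = y.
Proof.
have [y0 ->] := scls_surj y; have [_ mi] := sp_env sp a.
have [y' y'E] := mi _ y0 (ovalP b).
by exists (@scls A G X (R_ob sp a) b y'); rewrite -[LHS]clsM y'E.
Qed.

(** Extending the [X]-factorization of [y0 ∘ j] along [j] and subtracting it leaves a map that kills
    [j]. That map factors through the third term [spW a], from which every map to [G] is zero modulo
    [X]. *)
Lemma jcls_inj (a : stable C X) (b : stable G X) (y : Hom (RF prt sp a) b) :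
  fmap (EC sp) y ∘ jcls prt sp a = 0 -> y = 0.
Proof.
have [y0 ->] := scls_surj y; rewrite -[LHS]clsM => y00.
have /factorsP[x [u [v [Xx yE]]]] : y0 ∘ spj sp a \in factors X (oval a) (oval b).
  exact/(@scls_eq0 A C X a (osub (spC sp) b)).
have [_ mi] := sp_env sp a; have [w wE] := mi _ u (spX sp Xx).
have [_ wc _] := prt_seq prt (sp_tri sp a).
have /wc[t /= tE] : (y0 - v ∘ w) ∘ spj sp a = 0.
  by rewrite compBl yE -(compA v) wE subrr.
have /cls_eq : cls X t = cls X 0 by rewrite cls0; exact: (sp_orth (ovalP b)).
rewrite subr0 => tX; apply/(@scls_eq0 A G X (R_ob sp a) b); rewrite -(subrK (v ∘ w) y0) tE.
apply: rpredD; first exact: factors_precomp.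
by apply/factorsP; exists x, w, v.
Qed.

Lemma DeltaGX_refl (s : rseq (GX prt fx sp)) :
  @refl_Delta _ _ _ (@DeltaX A S C X RC prt fx) (EC sp) (RF prt sp)
    (jG prt sp) (GX prt fx sp) (fun a => idm _) s
  <-> DeltaGX s.
Proof.
split.
  by case=> s0 [a [b [c [f [g [h [Df ->]]]]]]]; rewrite comp1m => i; exists a, b, c, f, g, h.
case=> a [b [c [f [g [h [Df i]]]]]].
exists (@RSeq (stable G X) (GX prt fx sp) a b (RF prt sp c) f
  (fmap (RF prt sp) g ∘ jG prt sp b) (fmap (RF prt sp) h)) => //.
by exists a, b, c, f, g, h; rewrite comp1m.
Qed.

Theorem DeltaGX_right_triangulated : right_stabilizing prt fx sp ->
  right_triangulated (@DeltaGX A S C X RC prt fx G sp).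
Proof.
move=> stab; apply: (right_triangulated_ext DeltaGX_refl).
apply: refl_right_triangulated.
- exact: DeltaX_right_triangulated.
- by [].
- exact: jcls_nat.
- exact: jcls_ex.
- exact: jcls_inj.
- by [].
- by move=> a; exact: isiso1.
- by move=> a b f; rewrite compm1 comp1m.
- exact: stab.
Qed.

End Right.

(** * The left-hand structures *)

Lemma factors_op (A : addcat) (X : addsub A) (a b : A) (f : @Hom A a b) :
  (f : @Hom (op A) b a) \in factors (opsub X) b a <-> f \in factors X a b.
Proof.
by split=> /factorsP[x [u [v [Xx e]]]]; apply/factorsP; exists x, v, u.
Qed.

Lemma isiso_op (A : addcat) (a b : A) (f : @Hom A a b) :
  @isiso (op A) b a f <-> isiso f.
Proof. by split=> -[g [e1 e2]]; exists g. Qed.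

Section LeftSequences.
Variables (T : addcat) (O : addfun T T).

Lemma riso_op (s t : rseq (opF O)) :
  riso s t <-> liso (lseq_of_op t) (lseq_of_op s).
Proof.
split=> -[al [be [ga [[e1 e2 e3] ai bi ci]]]]; exists ga, be, al;
  by split; [split; exact: esym | exact/isiso_op..].
Qed.

Lemma liso_sym (s t : lseq O) : liso s t -> liso t s.
Proof.
case: s => a b c f g h; case: t => a' b' c' f' g' h'.
move=> /(riso_op (RSeq_ (S := opF O) (h' : @Hom (op T) _ _) g' f')
  (RSeq_ (S := opF O) (h : @Hom (op T) _ _) g f))/riso_sym.
by move/riso_op.
Qed.

End LeftSequences.

Section Coreflection.
Variables (T G : addcat) (O : addfun T T) (N : lseq O -> Prop).
Hypothesis ltN : left_triangulated N.
Variables (E : addfun G T) (Q : addfun T G) (r : forall a : T, Hom (E (Q a)) a).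
Hypothesis E_inj : forall (a b : G) (p q : Hom a b), fmap E p = fmap E q -> p = q.
Hypothesis r_nat : forall (a b : T) (f : Hom a b),
  r b ∘ fmap E (fmap Q f) = f ∘ r a.
Hypothesis r_ex : forall (a : T) (b : G) (y : Hom (E b) a),
  exists y', r a ∘ fmap E y' = y.
Hypothesis r_inj : forall (a : T) (b : G) (y : Hom b (Q a)),
  r a ∘ fmap E y = 0 -> y = 0.
Variable rG : forall b : G, Hom (Q (E b)) b.
Hypothesis rGE : forall b, fmap E (rG b) = r (E b).
Variables (OG : addfun G G) (w : forall a : G, Hom (OG a) (Q (O (E a)))).
Hypothesis w_iso : forall a, isiso (w a).
Hypothesis w_nat : forall (a b : G) (f : Hom a b),
  w b ∘ fmap OG f = fmap Q (fmap O (fmap E f)) ∘ w a.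
Hypothesis stab : forall (a b k l : T) (f : Hom a b)
    (v : Hom (O (E (Q b))) k) (u : Hom k (E (Q a))) (v' : Hom (O b) l) (u' : Hom l a),
    N (LSeq v u (fmap E (fmap Q f))) -> N (LSeq v' u' f) ->
    exists s : Hom k l,
      lmor (s := LSeq v u (fmap E (fmap Q f))) (t := LSeq v' u' f) s (r a) (r b) /\
      isiso (fmap Q s).

Definition corefl_Nabla (t : lseq OG) : Prop :=
  exists (a b : G) (k : T) (v : Hom (O (E b)) k) (u : Hom k (E a)) (f : Hom a b),
    N (LSeq v u (fmap E f)) /\
    liso (@LSeq G OG (Q k) a b (fmap Q v ∘ w b) (rG a ∘ fmap Q u) f) t.

(** The result on reflections, read in the opposite categories. An isomorphism of opposite sequences
    is one of left sequences in the reverse direction, hence the appeals to [liso_sym]. *)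
Theorem corefl_left_triangulated : left_triangulated corefl_Nabla.
Proof.
apply: (@right_triangulated_ext _ _ (@refl_Delta (op T) (op G) (opF O)
  (fun s => N (lseq_of_op s)) (opF E) (opF Q) rG (opF OG) w)).
  move=> s; split.
    case=> s0 [a [b [c [f [g [h [Df ->]]]]]]] i; exists b, a, c, h, g, f; split=> //.
    exact: liso_sym (proj1 (riso_op _ s) i).
  case=> a [b [k [v [u [f [Df i]]]]]].
  exists (@RSeq (op G) (opF OG) b a (Q k) f (rG a ∘ fmap Q u) (fmap Q v ∘ w b)).
    by exists b, a, k, f, u, v.
  exact/riso_op/liso_sym.
apply: refl_right_triangulated => //.
- by move=> a b p q; exact: E_inj.
- by move=> a b f; exact: r_nat.
- by move=> a b y; exact: r_ex.
- by move=> a b y; exact: r_inj.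
- by move=> b; exact: rGE.
- by move=> a; apply/isiso_op; exact: w_iso.
- by move=> a b f; have /= <- := w_nat f.
- move=> a b c d f g h k l Df Dd.
  have [s [[e1 e2 e3] si]] := stab Dd Df.
  by exists s; split; [split; exact: esym | exact/isiso_op].
Qed.

End Coreflection.

Section Left.
Variables (A : addcat) (O : addfun A A) (F X : addsub A) (LF : lseq O -> Prop).
Hypothesis plt : partial_left_triangulated F X LF.
Variable fx : lfixed F X LF.

Lemma OmegaX_cls (a b : objs F) (f : @Hom A a b) (k : Hom (lU fx a) (lU fx b))
    (sg : Hom (lX fx a) (lX fx b)) :
  lpi fx b ∘ sg = f ∘ lpi fx a -> liota fx b ∘ k = sg ∘ liota fx a ->
  k ∘ lnu fx a = lnu fx b ∘ fmap O f ->
  fmap (OmegaX plt fx) (scls X f) = @scls A F X (OmegaX_ob plt fx a) (OmegaX_ob plt fx b) k.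
Proof. by move=> e1 e2 e3; apply: indmapE; exists sg. Qed.

Let T : addcat := op (stable F X).
Let clop (a b : T) (f : @Hom (op A) (oval a) (oval b)) : Hom a b := @scls A F X b a f.

Lemma NablaX_model (s : rseq (opF (OmegaX plt fx))) :
  @model_Delta (op A) (opF O) (opsub X) (fun s => LF (lseq_of_op s)) T (@oval A F) clop
    (opF (OmegaX plt fx)) (lX fx) (lpi fx) (liota fx) (lnu fx) s
  <-> NablaX (lseq_of_op s).
Proof.
split.
  case=> s0 [a [b [c [f [g [h [de [xi [[R e1 e2 e3] ->]]]]]]]]] i.
  exists c, b, a, h, g, f, de, xi; split=> //.
  exact: liso_sym (proj1 (riso_op _ s) i).
case=> k [a [b [u [v [f [de [ze [R e1 e2 e3 i]]]]]]]].
exists (@RSeq T (opF (OmegaX plt fx)) b a k (scls X f) (scls X v) (scls X ze)).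
  by exists b, a, k, f, v, u, de, ze.
exact/riso_op/liso_sym.
Qed.

Theorem NablaX_left_triangulated : left_triangulated (@NablaX A O F X LF plt fx).
Proof.
apply: (right_triangulated_ext NablaX_model).
apply: (@model_right_triangulated (op A) (opF O) (opsub F) (opsub X) _ plt T (@oval A F)).
- by move=> a; exact: (@ovalP A F a).
- exact: (@objs_ind A F).
- by move=> a b q; exact: scls_surj.
- by move=> a b f g; exact: sclsD.
- by move=> a; exact: scls1.
- by move=> a b c g f; exact: sclsM.
- by move=> a b f; exact: iff_trans (@scls_eq0 A F X b a f) (iff_sym (factors_op X f)).
- exact: lfixed_tri.
- exact: lfixed_cov.
- by move=> a b f k sg e1 e2 e3; exact: OmegaX_cls e1 e2 e3.
Qed.

Lemma NablaX_cocone (a b : objs F) (f : @Hom A a b) :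
  let f1 := lpi fx b ∘ pr1 (lX fx b) (oval a) + f ∘ pr2 (lX fx b) (oval a) in
  exists (k : objs F) (u : Hom (oval k) (bip (lX fx b) (oval a)))
    (v : Hom (O (oval b)) (oval k)) (s : @Hom A (OmegaX_ob plt fx b) k),
  [/\ LF (LSeq v u f1) /\ is_epic X f1,
      u ∘ s = in1 (lX fx b) (oval a) ∘ liota fx b, s ∘ lnu fx b = v,
      LF (LSeq (lnu fx b ∘ fmap O f) s (- (pr2 (lX fx b) (oval a) ∘ u))) /\
        is_epic X (- (pr2 (lX fx b) (oval a) ∘ u)) &
      NablaX (@LSeq (stable F X) (OmegaX plt fx) k a b (scls X s)
        (@scls A F X k a (pr2 (lX fx b) (oval a) ∘ u)) (scls X f))].
Proof.
have [k [u [v [s [Fk R [e1 e2] R' m']]]]] :=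
  @RC_mapping_cone (op A) (opF O) (opsub F) (opsub X) _ plt _ _ _ _ _ _ _ f
    (lfixed_tri fx b) (lfixed_cov fx b) (ovalP b) (ovalP a).
exists (@InSub A F k Fk), u, v, s; split=> //.
  split=> //; apply: (@monic_push (op A) (opsub X)); by case: (lfixed_cov fx b).
apply/(NablaX_model (@RSeq T (opF (OmegaX plt fx)) b a (@InSub A F k Fk) _ _ _)).
refine (@cone_std (op A) (opF O) (opsub F) (opsub X) _ plt T (@oval A F) _ _ clop _ _ _ _
  (opF (OmegaX plt fx)) (lX fx) _ _ _ _ b a (@InSub A F k Fk) f u v s R e1 e2).
- by move=> x; exact: (@ovalP A F x).
- exact: (@objs_ind A F).
- by move=> x y g h; exact: sclsD.
- by move=> x; exact: scls1.
- by move=> x y z g h; exact: sclsM.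
- by move=> x y g; exact: iff_trans (@scls_eq0 A F X y x g) (iff_sym (factors_op X g)).
- exact: lfixed_cov.
Qed.

Variables (G : addsub A) (sc : special_precovering F X LF G).

Lemma rcls_nat (a b : stable F X) (f : Hom a b) :
  rcls plt sc b ∘ fmap (EF sc) (fmap (QF plt sc) f) = f ∘ rcls plt sc a.
Proof.
have [f0 ->] := scls_surj f.
have [_ mi] := sc_cov sc b; have [Ga _] := sc_cov sc a.
have [f' f'E] := mi _ (f0 ∘ scr sc a) Ga.
rewrite /QF /= (indmapE (r := Q_rel plt sc) (f' := f')) //.
by rewrite -[LHS]clsM f'E -[RHS]clsM.
Qed.

Lemma rcls_ex (a : stable F X) (b : stable G X) (y : Hom (EF sc b) a) :
  exists y', rcls plt sc a ∘ fmap (EF sc) y' = y.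
Proof.
have [y0 ->] := scls_surj y; have [_ mi] := sc_cov sc a.
have [y' y'E] := mi _ y0 (ovalP b).
by exists (@scls A G X b (Q_ob sc a) y'); rewrite -[LHS]clsM y'E.
Qed.

Lemma rcls_inj (a : stable F X) (b : stable G X) (y : Hom b (QF plt sc a)) :
  rcls plt sc a ∘ fmap (EF sc) y = 0 -> y = 0.
Proof.
have [y0 ->] := scls_surj y; rewrite -[LHS]clsM => y00.
have /factorsP[x [u [v [Xx yE]]]] : scr sc a ∘ y0 \in factors X (oval b) (oval a).
  exact/(@scls_eq0 A F X (osub (scF sc) b) a).
have [_ mi] := sc_cov sc a; have [w wE] := mi _ v (scX sc Xx).
have [_ wc _] := prt_seq plt (s := @RSeq (op A) (opF O) (oval a) _ _
  (scr sc a) (scg sc a) (sch sc a)) (sc_tri sc a).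
have /wc[t /= tE] : scr sc a ∘ (y0 - w ∘ u) = 0.
  by rewrite compBr yE (compA _ w) wE subrr.
have /cls_eq : cls X t = cls X 0 by rewrite cls0; exact: (sc_orth (ovalP b)).
rewrite subr0 => tX; apply/(@scls_eq0 A G X b (Q_ob sc a)); rewrite -(subrK (w ∘ u) y0) tE.
apply: rpredD; first exact: factors_postcomp.
by apply/factorsP; exists x, u, w.
Qed.

Lemma NablaGX_corefl (t : lseq (HX plt fx sc)) :
  @corefl_Nabla _ _ _ (@NablaX A O F X LF plt fx) (EF sc) (QF plt sc) (rG plt sc)
    (HX plt fx sc) (fun a => idm _) t
  <-> NablaGX t.
Proof.
split=> -[a [b [k [v [u [f [N i]]]]]]]; exists a, b, k, v, u, f; split=> //.
  by rewrite compm1 in i.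
by rewrite compm1.
Qed.

Theorem NablaGX_left_triangulated : left_stabilizing plt fx sc ->
  left_triangulated (@NablaGX A O F X LF plt fx G sc).
Proof.
move=> stab.
apply: (@right_triangulated_ext _ _ (fun s => corefl_Nabla _ _ _ (lseq_of_op s))).
  by move=> s; exact: NablaGX_corefl.
apply: corefl_left_triangulated.
- exact: NablaX_left_triangulated.
- by [].
- exact: rcls_nat.
- exact: rcls_ex.
- exact: rcls_inj.
- by [].
- by move=> a; exact: isiso1.
- by move=> a b f; rewrite compm1 comp1m.
- exact: stab.
Qed.

End Left.

(** * The adjunction and the gluing conditions *)

Section AdjunctionOfRelation.
Variables (T U : addcat) (L : addfun T U) (R : addfun U T).
Variable Th : forall (a : T) (d : U), Hom (L a) d -> Hom a (R d) -> Prop.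
Hypothesis Th_exr : forall a d (y : Hom (L a) d), exists z, Th y z.
Hypothesis Th_exl : forall a d (z : Hom a (R d)), exists y, Th y z.
Hypothesis Th_eqr : forall a d (y : Hom (L a) d) z z', Th y z -> Th y z' -> z = z'.
Hypothesis Th_eql : forall a d (y y' : Hom (L a) d) z, Th y z -> Th y' z -> y = y'.
Hypothesis Th_natl : forall a a' d (f : Hom a' a) (y : Hom (L a) d) z,
  Th y z -> Th (y ∘ fmap L f) (z ∘ f).
Hypothesis Th_natr : forall a d d' (g : Hom d d') (y : Hom (L a) d) z,
  Th y z -> Th (g ∘ y) (fmap R g ∘ z).

Let eta (a : T) := sval (cid (Th_exr (idm (L a)))).
Let eps (d : U) := sval (cid (Th_exl (idm (R d)))).

(** Unit and counit are the partners of the identities, and each adjunction law compares two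
    partners of one morphism. A relation is used because the correspondence is given by existence of
    lifts in [A], not by a formula. *)
Lemma adjunction_of_rel : exists adj : adjunction L R,
  forall a d (y : Hom (L a) d) (z : Hom a (R d)),
  Th y z -> z = fmap R y ∘ unit_ adj a /\ y = counit adj d ∘ fmap L z.
Proof.
have etaP a : Th (idm (L a)) (eta a) by rewrite /eta; case: cid.
have epsP d : Th (eps d) (idm (R d)) by rewrite /eps; case: cid.
have eta1 a d (y : Hom (L a) d) : Th y (fmap R y ∘ eta a).
  by have := Th_natr y (etaP a); rewrite compm1.
have eps1 a d (z : Hom a (R d)) : Th (eps d ∘ fmap L z) z.
  by have := Th_natl z (epsP d); rewrite comp1m.
unshelve eexists (@Adj T U L R eta eps _ _ _ _).
- move=> a a' f; apply: Th_eqr (eta1 _ _ _).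
  by have := Th_natl f (etaP a'); rewrite comp1m.
- move=> d d' g; apply: Th_eql (eps1 _ _ _) _.
  by have := Th_natr g (epsP d); rewrite compm1.
- by move=> a; apply: Th_eql (eps1 _ _ _) _.
- by move=> d; apply: Th_eqr (eta1 _ _ _) _.
- by move=> a d y z yz; split; [apply: Th_eqr (eta1 _ _ _) | apply: Th_eql (eps1 _ _ _)].
Qed.

End AdjunctionOfRelation.

Section PrePartial.
Variables (A : addcat) (O S : addfun A A) (F C X : addsub A)
  (LF : lseq O -> Prop) (RC : rseq S -> Prop).
Variable P : pre_partial_triangulated F C X LF RC.
Let prt := pp_right P.
Let plt := pp_left P.
Let rx := pp_rfix P.
Let lx := pp_lfix P.
Let adj := pp_adj P.
Let sp := pp_pre P.
Let sc := pp_cov P.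
Let psi a b (f : Hom (O a) b) := adj_psi adj f.
Let psiV a b (f : Hom a (S b)) := adj_psiV adj f.

Lemma psi_comp (a a' b : A) (u : Hom (O a) b) (f : Hom a' a) :
  psi (u ∘ fmap O f) = psi u ∘ f.
Proof. by rewrite /psi /adj_psi fmapM -!compA unit_nat. Qed.

Lemma psi_psiV (a b b' : A) (g : Hom b b') (h : Hom a (S b)) :
  psi (g ∘ psiV h) = fmap S g ∘ h.
Proof.
rewrite /psi /adj_psi /psiV /adj_psiV !fmapM -!compA -unit_nat.
by rewrite (compA _ (unit_ adj _)) adj_tri2 comp1m.
Qed.

Lemma psiV_comp (a b b' : A) (g : Hom b b') (h : Hom a (S b)) :
  psiV (fmap S g ∘ h) = g ∘ psiV h.
Proof. by rewrite /psiV /adj_psiV fmapM compA counit_nat compA. Qed.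

Lemma psiV_precomp (a a' b : A) (h : Hom a (S b)) (f : Hom a' a) :
  psiV (h ∘ f) = psiV h ∘ fmap O f.
Proof. by rewrite /psiV /adj_psiV fmapM compA. Qed.

Lemma psiN (a b : A) (u : Hom (O a) b) : psi (- u) = - psi u.
Proof. by rewrite /psi /adj_psi fmapN compNm. Qed.

Lemma psiVK (a b : A) (u : Hom (O a) b) : psiV (psi u) = u.
Proof.
by rewrite /psiV /adj_psiV /psi /adj_psi fmapM compA counit_nat -compA adj_tri1 compm1.
Qed.

(** Passes between the sign condition of (c)(i) and (d), stated through [psiV], and that of (c)(ii)
    and (e), stated through [psi]. *)
Lemma psi_signE (c n a l : A) (h : Hom c (S a)) (u : Hom (O n) l) (al : Hom a l)
    (ga : Hom c n) :
  u ∘ fmap O ga = - (al ∘ psiV h) <-> fmap S al ∘ h = - (psi u ∘ ga).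
Proof.
split=> e.
  by rewrite -psi_psiV -psi_comp e psiN opprK.
by rewrite -[LHS]psiVK psi_comp -[psi u ∘ ga]opprK -e -psi_psiV -psiN psiVK.
Qed.

(* The maps alpha : A -> U_D and gamma : U^A -> D are the outer components of a
   morphism from A -> X^A -> U^A to U_D -> X_D -> D.  Modulo X this relation is a
   bijection, which yields the adjunction of G^X and H_X. *)
Definition rho (a : objs C) (d : objs F) (al : Hom (oval a) (lU lx d))
    (ga : Hom (rU rx a) (oval d)) : Prop :=
  exists be : Hom (rX rx a) (lX lx d),
    [/\ liota lx d ∘ al = be ∘ ri rx a, lpi lx d ∘ be = ga ∘ rp rx a &
        lnu lx d ∘ fmap O ga = - (al ∘ psiV (rq rx a))].

Lemma rho_exr (a : objs C) (d : objs F) (al : Hom (oval a) (lU lx d)) :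
  exists ga, @rho a d al ga.
Proof.
have [_ mi] := rfixed_env rx a; have [Xd ed] := lfixed_cov lx d.
have [be beE] := mi _ (liota lx d ∘ al) Xd.
have [_ H] := pp_c P be (rfixed_tri rx a) mi (lfixed_tri lx d) ed.
have [ga [e1 e2]] := H al (esym beE).
by exists ga, be; split=> //; apply/psi_signE.
Qed.

Lemma rho_exl (a : objs C) (d : objs F) (ga : Hom (rU rx a) (oval d)) :
  exists al, @rho a d al ga.
Proof.
have [Xa mi] := rfixed_env rx a; have [_ ed] := lfixed_cov lx d.
have [be beE] := ed _ (ga ∘ rp rx a) Xa.
have [H _] := pp_c P be (rfixed_tri rx a) mi (lfixed_tri lx d) ed.
have [al [e1 e2]] := H ga (esym beE).
by exists al, be.
Qed.

Lemma rhoB (a : objs C) (d : objs F) al ga al' ga' :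
  @rho a d al ga -> @rho a d al' ga' -> @rho a d (al - al') (ga - ga').
Proof.
move=> [be [e1 e2 e3]] [be' [e1' e2' e3']]; exists (be - be'); split.
- by rewrite compBr compBl e1 e1'.
- by rewrite compBr compBl e2 e2'.
- by rewrite fmapD fmapN compBr compBl e3 e3' opprD.
Qed.

(** This is (d): a [ga] that factors through [X] lifts along the precover of [d]. With [rhoB] it
    gives uniqueness of [al] modulo [X]. *)
Lemma rho_factors_r (a : objs C) (d : objs F) al ga :
  @rho a d al ga -> F (oval a) -> ga \in factors X _ _ -> al \in factors X _ _.
Proof.
move=> [be [e1 e2 e3]] Fa /factorsP[x [u [v [Xx gaE]]]].
have [Xa mi] := rfixed_env rx a; have [_ ed] := lfixed_cov lx d.
have [w wE] := ed _ v Xx.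
have [|k ->] := pp_d Fa (lfixed_tri lx d) ed e1 e2 e3.
  by exists (w ∘ u); rewrite compA wE.
by apply/factorsP; exists (rX rx a), (ri rx a), k.
Qed.

(** This is (e), with [al] extended along the preenvelope of [a]. *)
Lemma rho_factors_l (a : objs C) (d : objs F) al ga :
  @rho a d al ga -> C (oval d) -> al \in factors X _ _ -> ga \in factors X _ _.
Proof.
move=> [be [e1 e2 /psi_signE e3]] Cd /(preenvelope_factors (rfixed_env rx a))[k kE].
have [Xa mi] := rfixed_env rx a; have [Xd ed] := lfixed_cov lx d.
have [|l ->] := pp_e Cd (rfixed_tri rx a) mi e1 e2 e3; first by exists k.
by apply/factorsP; exists (lX lx d), l, (lpi lx d).
Qed.

Lemma rho_natl (a a' : objs C) (d : objs F) al ga (f : @Hom A a' a)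
    (k : Hom (rU rx a') (rU rx a)) :
  kappa_rel (prt := prt) (fx := rx) f k ->
  @rho a d al ga -> @rho a' d (al ∘ f) (ga ∘ k).
Proof.
move=> [sg [s1 s2 s3]] [be [e1 e2 e3]]; exists (be ∘ sg); split.
- by rewrite compA e1 -!compA s1.
- by rewrite compA e2 -!compA s2.
- by rewrite fmapM compA e3 compNm -compA -psiV_precomp s3 psiV_comp compA.
Qed.

Lemma rho_natr (a : objs C) (d d' : objs F) al ga (f : @Hom A d d')
    (k : Hom (lU lx d) (lU lx d')) :
  lkappa_rel (plt := plt) (fx := lx) f k ->
  @rho a d al ga -> @rho a d' (k ∘ al) (f ∘ ga).
Proof.
move=> [sg [s1 s2 s3]] [be [e1 e2 e3]]; exists (sg ∘ be); split.
- by rewrite compA s2 -!compA e1.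
- by rewrite compA s1 -!compA e2.
- by rewrite fmapM compA -s3 -!compA e3 compmN.
Qed.

(** * Strict lifts for the two gluing conditions *)

Section GlueLifts.
Variables (a : objs C) (b n : A) (f : Hom (oval a) b) (u : Hom (bip (rX rx a) b) n)
  (v : Hom n (S (oval a))) (s : Hom n (rU rx a)).
Variables (d : objs F) (b' l : A) (f' : Hom b' (oval d)) (u' : Hom l (bip (lX lx d) b'))
  (v' : Hom (O (oval d)) l) (s' : Hom (lU lx d) l).
Let f1 := in1 (rX rx a) b ∘ ri rx a + in2 (rX rx a) b ∘ f.
Let f1' := lpi lx d ∘ pr1 (lX lx d) b' + f' ∘ pr2 (lX lx d) b'.
Hypothesis uf : u ∘ f1 = 0.
Hypothesis fu' : f1' ∘ u' = 0.
Hypothesis su : s ∘ u = rp rx a ∘ pr1 (rX rx a) b.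
Hypothesis us' : u' ∘ s' = in1 (lX lx d) b' ∘ liota lx d.
Hypothesis qs : rq rx a ∘ s = v.
Hypothesis sn' : s' ∘ lnu lx d = v'.

(** Axiom (c)(ii) is applied to the cone of [f] and to the rotated cocone of [f']. The second
    conclusion is a sum, not a difference, because the adjunction pairs [al] with the class of
    [- ga]. *)
Lemma glue_lift_b (al : Hom (oval a) (lU lx d)) (ga : Hom (rU rx a) (oval d))
    (be : Hom b l) :
  C (oval d) -> is_monic X f1 -> RC (RSeq f1 u v) ->
  LF (LSeq (lnu lx d ∘ fmap O f') s' (- (pr2 _ _ ∘ u'))) ->
  is_epic X (- (pr2 _ _ ∘ u')) ->
  rho al ga -> be ∘ f - s' ∘ al \in factors X _ _ ->
  exists ga0 : Hom n b', ga0 ∘ (u ∘ in2 _ _) = pr2 _ _ ∘ u' ∘ be /\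
    f' ∘ ga0 + ga ∘ s \in factors X _ _.
Proof.
move=> Cd mf Rf Lf ef [be1 [e1 e2 /psi_signE e3]].
move=> /(preenvelope_factors (rfixed_env rx a))[k kE].
(* The summand [X^A] of the cone absorbs the error [k ∘ ri rx a], so that the square on [f1]
   commutes strictly. *)
pose be2 := be ∘ pr2 _ _ - k ∘ pr1 (rX rx a) b.
have be2E : be2 ∘ f1 = s' ∘ al.
  by rewrite /be2 /f1; bip_simp; rewrite -kE opprB addrCA subrr addr0.
have [_ /(_ al (esym be2E))[g [g1 g2]]] := pp_c P be2 Rf mf Lf ef.
exists (- g); split.
  by rewrite compNm compA g1 /be2; bip_simp.
have [Xd _] := lfixed_cov lx d.
(* The error is the third component of a ladder from the cone to the fixed left triangle of [d] with
   first component [0]. As [0] factors through [f1], (e) applies. *)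
have [||||k' ->] := pp_e (d := d) (al := 0) (be := be1 ∘ pr1 _ _ - pr1 _ _ ∘ u' ∘ be2)
  (ga := f' ∘ (- g) + ga ∘ s) Cd Rf mf.
- rewrite compm0 compBl -(compA _ be2) be2E -!compA (compA u') us' /f1; bip_simp.
  by rewrite e1 subrr.
- have fuE : lpi lx d ∘ (pr1 _ _ ∘ u') = - (f' ∘ (pr2 _ _ ∘ u')).
    by apply/eqP; rewrite -addr_eq0; move: fu'; rewrite /f1' compDl -!compA => ->.
  have -> : (f' ∘ (- g) + ga ∘ s) ∘ u = f' ∘ (pr2 _ _ ∘ u') ∘ be2 + ga ∘ rp rx a ∘ pr1 _ _.
    by rewrite compDl -!compA su compNm g1 compNm opprK -!compA.
  rewrite compBr !compA e2 -(compA (lpi lx d)) fuE compNm opprK.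
  by rewrite addrC !compA.
- rewrite fmap0 comp0m compDr compmN -/(psi _) compmN !compA -psi_comp -compA.
  have := g2; rewrite -qs compA e3 => /(congr1 -%R).
  rewrite !opprK -/(psi _) compNm opprK -compA => ->.
  by rewrite addrC subrr oppr0.
- by exists 0; rewrite comp0m.
by apply/factorsP; exists (lX lx d), k', (lpi lx d).
Qed.

(** The mirror image: (c)(i) is applied to the rotated cone of [f] and to the cocone of [f'], with
    third component [- ga]. *)
Lemma glue_lift_c (al : Hom (oval a) (lU lx d)) (ga : Hom (rU rx a) (oval d))
    (be : Hom n b') :
  F (oval a) -> LF (LSeq v' u' f1') -> is_epic X f1' ->
  RC (RSeq (- (u ∘ in2 _ _)) s (fmap S f ∘ rq rx a)) ->
  is_monic X (- (u ∘ in2 _ _)) ->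
  rho al ga -> f' ∘ be + ga ∘ s \in factors X _ _ ->
  exists al0 : Hom b l, pr2 _ _ ∘ u' ∘ al0 = be ∘ (u ∘ in2 _ _) /\
    al0 ∘ f - s' ∘ al \in factors X _ _.
Proof.
move=> Fa Lf ef Rf mf [be1 [e1 e2 e3]] /factorsP[x [y [z [Xx E]]]].
have [Xa mi] := rfixed_env rx a; have [_ ed] := lfixed_cov lx d.
have [z' z'E] := ed _ z Xx.
(* The error [z ∘ y] is lifted along the precover of [d] and absorbed by the summand [X_D]. *)
pose be2 := in2 _ _ ∘ be - in1 (lX lx d) b' ∘ (z' ∘ y).
have be2E : (- ga) ∘ s = f1' ∘ be2.
  rewrite /be2 /f1'; bip_simp.
  have -> : ga ∘ s = z ∘ y - f' ∘ be by rewrite -E addrC addKr.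
  by rewrite (compA _ z') z'E opprB addrC.
have [/(_ _ be2E)[g [g1 g2]] _] := pp_c P be2 Rf mf Lf ef.
exists (- g); split.
  by rewrite compmN -compA g1 /be2; bip_simp.
have uE : u ∘ in2 _ _ ∘ f = - (u ∘ in1 _ _ ∘ ri rx a).
  by apply/eqP; rewrite -addr_eq0 addrC -!compA -compDr uf.
(* The error is the first component of a ladder from the fixed triangle of [a] to the cocone with
   third component [0], so (d) applies. *)
have [||||k ->] := pp_d (a := a) (al := (- g) ∘ f - s' ∘ al)
  (be := - (be2 ∘ (u ∘ in1 _ _)) - in1 _ _ ∘ be1) (ga := 0) Fa Lf ef.
- rewrite compBr compBl compNm compmN compNm !compA g1 us'.
  rewrite compmN !compNm opprK -!compA (compA u) uE -!compA e1 compmN.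
  by rewrite !compA.
- rewrite comp0m compBr compmN (compA f1') -be2E compNm compNm opprK -!compA (compA s) su.
  rewrite /f1'; bip_simp.
  by rewrite e2 subrr.
- have gE : g ∘ f ∘ psiV (rq rx a) = v' ∘ fmap O ga.
    by apply: oppr_inj; rewrite -[in LHS]compA -psiV_comp -[RHS]compmN -fmapN g2.
  have sE : s' ∘ al ∘ psiV (rq rx a) = - (v' ∘ fmap O ga).
    by rewrite -sn' -!compA e3 compmN opprK.
  rewrite fmap0 compm0 -/(psiV _) compBl !compNm.
  by rewrite [g ∘ f ∘ _]gE [s' ∘ al ∘ _]sE subrr oppr0.
- by exists 0; rewrite compm0.
by apply/factorsP; exists (rX rx a), (ri rx a), k.
Qed.

End GlueLifts.

Let Gs := subcatI C F.
Let toC (a : objs Gs) : objs C := osub (spC sp) a.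
Let toF (a : objs Gs) : objs F := osub (scF sc) a.

(* The sign on gamma makes the gluing squares commute without a sign. *)
Definition Theta (a d : stable Gs X) (y : Hom (GX prt rx sp a) d)
    (z : Hom a (HX plt lx sc d)) : Prop :=
  exists al ga, [/\ @rho (toC a) (toF d) al ga,
    fmap (EC sp) y ∘ jcls prt sp (SigmaX_ob prt rx (toC a)) =
      - @scls A C X (SigmaX_ob prt rx (toC a)) (toC d) ga &
    rcls plt sc (OmegaX_ob plt lx (toF d)) ∘ fmap (EF sc) z =
      @scls A F X (toF a) (OmegaX_ob plt lx (toF d)) al].

Lemma jcls_eq (a : stable C X) (b : stable Gs X) (y y' : Hom (RF prt sp a) b) :
  fmap (EC sp) y ∘ jcls prt sp a = fmap (EC sp) y' ∘ jcls prt sp a -> y = y'.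
Proof. exact: (j_eq (@jcls_inj A S C X RC prt Gs sp)). Qed.

Lemma rcls_eq (a : stable F X) (b : stable Gs X) (y y' : Hom b (QF plt sc a)) :
  rcls plt sc a ∘ fmap (EF sc) y = rcls plt sc a ∘ fmap (EF sc) y' -> y = y'.
Proof.
move=> e; apply/eqP; rewrite -subr_eq0; apply/eqP/rcls_inj.
by rewrite fmapD fmapN compBr e subrr.
Qed.

Lemma sclsN (G : addsub A) (a b : objs G) (f : @Hom A a b) : scls X (- f) = - scls X f.
Proof. exact: raddfN. Qed.

Lemma scls_eqP (G : addsub A) (a b : objs G) (f g : @Hom A a b) :
  scls X f = scls X g <-> f - g \in factors X (oval a) (oval b).
Proof. exact: cls_eq. Qed.

Lemma Theta_exr a d (y : Hom (GX prt rx sp a) d) : exists z, @Theta a d y z.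
Proof.
have [ga gaE] := scls_surj (- (fmap (EC sp) y ∘ jcls prt sp (SigmaX_ob prt rx (toC a)))).
have [al r] := @rho_exl (toC a) (toF d) ga.
have [z zE] := @rcls_ex A O F X LF plt Gs sc (OmegaX_ob plt lx (toF d)) a
  (@scls A F X (toF a) (OmegaX_ob plt lx (toF d)) al).
by exists z, al, ga; split=> //; rewrite -gaE opprK.
Qed.

Lemma Theta_exl a d (z : Hom a (HX plt lx sc d)) : exists y, @Theta a d y z.
Proof.
have [al alE] := scls_surj (rcls plt sc (OmegaX_ob plt lx (toF d)) ∘ fmap (EF sc) z).
have [ga r] := @rho_exr (toC a) (toF d) al.
have [y yE] := @jcls_ex A S C X RC prt Gs sp (SigmaX_ob prt rx (toC a)) d
  (- @scls A C X (SigmaX_ob prt rx (toC a)) (toC d) ga).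
by exists y, al, ga.
Qed.

Lemma Theta_eqr a d y z z' : @Theta a d y z -> @Theta a d y z' -> z = z'.
Proof.
move=> [al [ga [r e1 e2]]] [al' [ga' [r' e1' e2']]]; apply: rcls_eq.
rewrite e2 e2'; apply/scls_eqP; apply: rho_factors_r (rhoB r r') (ovalP (toF a)) _.
by apply/(@scls_eqP _ (SigmaX_ob prt rx (toC a)) (toC d)); apply: oppr_inj; rewrite -e1.
Qed.

Lemma Theta_eql a d y y' z : @Theta a d y z -> @Theta a d y' z -> y = y'.
Proof.
move=> [al [ga [r e1 e2]]] [al' [ga' [r' e1' e2']]]; apply: jcls_eq.
rewrite e1 e1'; congr (- _).
apply/scls_eqP; apply: rho_factors_l (rhoB r r') (ovalP (toC d)) _.
by apply/(@scls_eqP _ (toF a) (OmegaX_ob plt lx (toF d))); rewrite -e2.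
Qed.

Lemma Theta_natl a a' d (f : Hom a' a) (y : Hom (GX prt rx sp a) d) z :
  Theta y z -> Theta (y ∘ fmap (GX prt rx sp) f) (z ∘ f).
Proof.
move=> [al [ga [r e1 e2]]]; have [f0 fE] := scls_surj f.
have [k kk] := irel_total (SigmaX_rel prt rx) (f0 : @Hom A (toC a') (toC a)).
exists (al ∘ f0), (ga ∘ k); split; first exact: rho_natl kk r.
- have sE : fmap (SigmaX prt rx) (fmap (EC sp) f) = scls X k.
    by rewrite fE; apply: indmapE kk.
  rewrite fmapM -compA (jcls_nat prt sp (fmap (SigmaX prt rx) (fmap (EC sp) f))).
  by rewrite compA e1 sE compNm; congr (- _); exact/esym/clsM.
- by rewrite fmapM compA e2 fE; exact/esym/clsM.
Qed.

Lemma Theta_natr a d d' (g : Hom d d') (y : Hom (GX prt rx sp a) d) z :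
  Theta y z -> Theta (g ∘ y) (fmap (HX plt lx sc) g ∘ z).
Proof.
move=> [al [ga [r e1 e2]]]; have [g0 gE] := scls_surj g.
have [k kk] := irel_total (OmegaX_rel plt lx) (g0 : @Hom A (toF d) (toF d')).
exists (k ∘ al), (g0 ∘ ga); split; first exact: rho_natr kk r.
- rewrite fmapM -compA e1 gE compmN; congr (- _).
  exact/esym/clsM.
- have sE : fmap (OmegaX plt lx) (fmap (EF sc) g) = scls X k.
    by rewrite gE; apply: indmapE kk.
  rewrite fmapM compA (rcls_nat plt sc (fmap (OmegaX plt lx) (fmap (EF sc) g))).
  by rewrite -compA e2 sE; exact/esym/clsM.
Qed.

Section GlueCones.
Variables (a b : objs Gs) (f : @Hom A a b) (n : objs C)
  (u : Hom (bip (rX rx (toC a)) (oval b)) (oval n)) (v : Hom (oval n) (S (oval a)))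
  (s : @Hom A n (SigmaX_ob prt rx (toC a))).
Variables (b' d : objs Gs) (f' : @Hom A b' d) (l : objs F)
  (u' : Hom (oval l) (bip (lX lx (toF d)) (oval b')))
  (v' : Hom (O (oval d)) (oval l)) (s' : @Hom A (OmegaX_ob plt lx (toF d)) l).
Let f1 := in1 (rX rx (toC a)) (oval b) ∘ ri rx (toC a) + in2 (rX rx (toC a)) (oval b) ∘ f.
Let f1' := lpi lx (toF d) ∘ pr1 (lX lx (toF d)) (oval b')
  + f' ∘ pr2 (lX lx (toF d)) (oval b').
Let u2 : @Hom A b n := u ∘ in2 (rX rx (toC a)) (oval b).
Let u2' : @Hom A l b' := pr2 (lX lx (toF d)) (oval b') ∘ u'.
Hypothesis Rf : RC (RSeq f1 u v) /\ is_monic X f1.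
Hypothesis su : s ∘ u = rp rx (toC a) ∘ pr1 (rX rx (toC a)) (oval b).
Hypothesis qs : rq rx (toC a) ∘ s = v.
Hypothesis Ru : RC (RSeq (- u2) s (fmap S f ∘ rq rx (toC a))) /\ is_monic X (- u2).
Hypothesis Lf : LF (LSeq v' u' f1') /\ is_epic X f1'.
Hypothesis us' : u' ∘ s' = in1 (lX lx (toF d)) (oval b') ∘ liota lx (toF d).
Hypothesis sn' : s' ∘ lnu lx (toF d) = v'.
Hypothesis Lu : LF (LSeq (lnu lx (toF d) ∘ fmap O f') s' (- u2')) /\ is_epic X (- u2').

Let uf : u ∘ f1 = 0.
Proof. by have [] := RC_comp0 prt Rf.1. Qed.

Let fu' : f1' ∘ u' = 0.
Proof.
by have [e _] := @RC_comp0 (op A) (opF O) (opsub F) (opsub X) _ plt _ _ _ f1' u' v' Lf.1.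
Qed.

Let g : @Hom (stable Gs X) b (RF prt sp n) :=
  fmap (RF prt sp) (@scls A C X (toC b) n u2) ∘ jG prt sp b.
Let g' : @Hom (stable Gs X) (QF plt sc l) b' :=
  rG plt sc b' ∘ fmap (QF plt sc) (@scls A F X l (toF b') u2').

(** The inclusion [EC sp] is the identity on classes, so the composite can be computed in [C/X],
    where naturality of [jcls] moves it past [RF]. *)
Lemma EC_g (c : stable Gs X) (y : Hom (RF prt sp n) c) (y0 : @Hom A n (toC c)) :
  fmap (EC sp) y ∘ jcls prt sp n = scls X y0 -> y ∘ g = @scls A Gs X b c (y0 ∘ u2).
Proof.
move=> yE; have e := jcls_nat prt sp (@scls A C X (toC b) n u2).
transitivity (fmap (EC sp) y ∘ (jcls prt sp n ∘ @scls A C X (toC b) n u2)).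
  by rewrite -e.
by rewrite compA yE; exact/esym/clsM.
Qed.

Lemma EF_g' (c : stable Gs X) (z : Hom c (QF plt sc l)) (z0 : @Hom A (toF c) l) :
  rcls plt sc l ∘ fmap (EF sc) z = scls X z0 -> g' ∘ z = @scls A Gs X c b' (u2' ∘ z0).
Proof.
move=> zE; have e := rcls_nat plt sc (@scls A F X l (toF b') u2').
transitivity (@scls A F X l (toF b') u2' ∘ rcls plt sc l ∘ fmap (EF sc) z).
  by rewrite -e.
by rewrite -compA zE; exact/esym/clsM.
Qed.

Lemma glue_cone_b (y : Hom (GX prt rx sp a) d) (al : @Hom (stable Gs X) a (HX plt lx sc d))
    (be : @Hom (stable Gs X) b (QF plt sc l)) :
  Theta y al -> be ∘ scls X f = fmap (QF plt sc) (scls X s') ∘ al ->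
  exists ga : @Hom (stable Gs X) (RF prt sp n) b',
    ga ∘ g = g' ∘ be /\ scls X f' ∘ ga = y ∘ fmap (RF prt sp) (scls X s).
Proof.
move=> [al0 [ga1 [r yE alE]]] sq.
have [be0 beE] := scls_surj (rcls plt sc l ∘ fmap (EF sc) be).
have [ga0 [e1 e2]] : exists ga0 : @Hom A n b', ga0 ∘ u2 = u2' ∘ be0 /\
    f' ∘ ga0 + ga1 ∘ s \in factors X (oval n) (oval d).
  apply: (glue_lift_b fu' su us' qs (ovalP (toC d)) Rf.2 Rf.1 Lu.1 Lu.2 r).
  apply/(@scls_eqP F (toF a) l).
  transitivity (rcls plt sc l ∘ fmap (EF sc) (be ∘ @scls A Gs X a b f)).
    by rewrite fmapM compA beE; exact: clsM.
  rewrite sq fmapM compA (rcls_nat plt sc (@scls A F X (OmegaX_ob plt lx (toF d)) l s')).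
  by rewrite -compA alE; exact/esym/clsM.
have [ga gaE] := @jcls_ex A S C X RC prt Gs sp n b' (@scls A C X n (toC b') ga0).
exists ga; rewrite (EC_g gaE) e1 -(EF_g' beE); split=> //.
apply: (@jcls_eq n d).
transitivity (@scls A C X n (toC d) (f' ∘ ga0)).
  by rewrite fmapM -compA gaE; exact/esym/clsM.
transitivity (- @scls A C X n (toC d) (ga1 ∘ s)).
  by rewrite -sclsN; apply/scls_eqP; rewrite opprK.
rewrite fmapM -compA (jcls_nat prt sp (@scls A C X n (SigmaX_ob prt rx (toC a)) s)).
by rewrite compA yE compNm; congr (- _); exact: clsM.
Qed.

Lemma glue_cone_c (y : Hom (GX prt rx sp a) d) (z : @Hom (stable Gs X) a (HX plt lx sc d))
    (be : @Hom (stable Gs X) (RF prt sp n) b') :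
  Theta y z -> scls X f' ∘ be = y ∘ fmap (RF prt sp) (scls X s) ->
  exists ga : @Hom (stable Gs X) b (QF plt sc l),
    g' ∘ ga = be ∘ g /\ ga ∘ scls X f = fmap (QF plt sc) (scls X s') ∘ z.
Proof.
move=> [al0 [ga1 [r yE zE]]] sq.
have [be0 beE] := scls_surj (fmap (EC sp) be ∘ jcls prt sp n).
have [al1 [e1 e2]] : exists al1 : @Hom A b l, u2' ∘ al1 = be0 ∘ u2 /\
    al1 ∘ f - s' ∘ al0 \in factors X (oval a) (oval l).
  apply: (glue_lift_c uf su us' sn' (ovalP (toF a)) Lf.1 Lf.2 Ru.1 Ru.2 r).
  rewrite -[ga1 ∘ s]opprK; apply/(@scls_eqP C n (toC d)); rewrite sclsN.
  transitivity (fmap (EC sp) (@scls A Gs X b' d f' ∘ be) ∘ jcls prt sp n).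
    by rewrite fmapM -compA beE; exact: clsM.
  rewrite sq fmapM -compA (jcls_nat prt sp (@scls A C X n (SigmaX_ob prt rx (toC a)) s)).
  by rewrite compA yE compNm; congr (- _); exact/esym/clsM.
have [ga gaE] := @rcls_ex A O F X LF plt Gs sc l b (@scls A F X (toF b) l al1).
exists ga; rewrite (EC_g beE) -e1 -(EF_g' gaE); split=> //.
apply: (@rcls_eq l a).
transitivity (@scls A F X (toF a) l (al1 ∘ f)).
  by rewrite fmapM compA gaE; exact/esym/clsM.
transitivity (@scls A F X (toF a) l (s' ∘ al0)); first exact/scls_eqP.
rewrite fmapM compA (rcls_nat plt sc (@scls A F X (OmegaX_ob plt lx (toF d)) l s')).
by rewrite -compA zE; exact: clsM.
Qed.

End GlueCones.

Lemma DeltaGX_cone (a b : objs Gs) (f : @Hom A a b) (n : objs C) (g : @Hom A b n)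
    (s : @Hom A n (SigmaX_ob prt rx (toC a))) :
  DeltaX (@RSeq (stable C X) (SigmaX prt rx) (toC a) (toC b) n
    (@scls A C X (toC a) (toC b) f) (@scls A C X (toC b) n g) (scls X s)) ->
  DeltaGX (@RSeq (stable Gs X) (GX prt rx sp) a b (RF prt sp n) (scls X f)
    (fmap (RF prt sp) (@scls A C X (toC b) n g) ∘ jG prt sp b)
    (fmap (RF prt sp) (scls X s))).
Proof.
move=> D; exists a, b, n, (scls X f), (@scls A C X (toC b) n g), (scls X s).
by split=> //; exact: riso_refl.
Qed.

Lemma NablaGX_cocone (a b : objs Gs) (f : @Hom A a b) (l : objs F) (g : @Hom A l a)
    (s : @Hom A (OmegaX_ob plt lx (toF b)) l) :
  NablaX (@LSeq (stable F X) (OmegaX plt lx) l (toF a) (toF b)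
    (scls X s) (@scls A F X l (toF a) g) (@scls A F X (toF a) (toF b) f)) ->
  NablaGX (@LSeq (stable Gs X) (HX plt lx sc) (QF plt sc l) a b
    (fmap (QF plt sc) (scls X s))
    (rG plt sc a ∘ fmap (QF plt sc) (@scls A F X l (toF a) g)) (scls X f)).
Proof.
move=> N; exists a, b, l, (scls X s), (@scls A F X l (toF a) g), (scls X f).
split=> //; exists (idm _), (idm _), (idm _); split; try exact: isiso1.
by split; rewrite ?fmap1 ?comp1m ?compm1.
Qed.

Lemma left_same_last (T : addcat) (W : addfun T T) (N : lseq W -> Prop)
    (k k' a b : T) (f : Hom (W b) k) (g : Hom k a) (h : Hom a b)
    (f' : Hom (W b) k') (g' : Hom k' a) : left_triangulated N ->
  N (LSeq f g h) -> N (LSeq f' g' h) ->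
  exists i : Hom k' k, [/\ isiso i, g ∘ i = g' & f = i ∘ f'].
Proof.
move=> ltN Nf Nf'.
have [i [ii e1 e2]] := @rt_same_first (op T) (opF W) _ b a k k' h g f g' f' ltN Nf Nf'.
by exists i; split=> //; exact/isiso_op.
Qed.

(** Isomorphisms [k] and [j], the identity on the objects that [f] and [h'] connect, compare the
    given triangles with the cone of a lift of [f] and the cocone of a lift of [h']. Composing with
    them or their inverses transports both gluing conditions, and [Theta] turns the counit and unit
    terms into partners of [al]. *)
Lemma pre_triangulated_glue : exists ad : adjunction (GX prt rx sp) (HX plt lx sc),
  forall (a b c : stable Gs X) (f : Hom a b) (g : Hom b c) (h : Hom c (GX prt rx sp a))
    (a' b' c' : stable Gs X) (f' : Hom (HX plt lx sc c') a') (g' : Hom a' b')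
    (h' : Hom b' c'),
  DeltaGX (RSeq f g h) -> NablaGX (LSeq f' g' h') ->
  (forall (al : Hom a (HX plt lx sc c')) (be : Hom b a'), be ∘ f = f' ∘ al ->
    exists ga : Hom c b', ga ∘ g = g' ∘ be /\
      h' ∘ ga = counit ad c' ∘ fmap (GX prt rx sp) al ∘ h) /\
  (forall (be : Hom c b') (al : Hom (GX prt rx sp a) c'), h' ∘ be = al ∘ h ->
    exists ga : Hom b a', g' ∘ ga = be ∘ g /\
      ga ∘ f = f' ∘ fmap (HX plt lx sc) al ∘ unit_ ad a).
Proof.
have [ad adE] := adjunction_of_rel Theta_exr Theta_exl Theta_eqr Theta_eql
  Theta_natl Theta_natr.
exists ad => a b c q g h a' b' d f' g' q' Dq Nq.
have rtD : right_triangulated _ := DeltaGX_right_triangulated (@pp_rstab _ _ _ _ _ _ _ _ P).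
have ltN : left_triangulated _ := NablaGX_left_triangulated (@pp_lstab _ _ _ _ _ _ _ _ P).
have [f fE] := scls_surj q; have [h' hE] := scls_surj q'.
rewrite fE in Dq *; rewrite hE in Nq *.
have [n [u [v [s [Rf su qs Ru Df]]]]] := @DeltaX_cone A S C X RC prt rx (toC a) (toC b) f.
have [l [u' [v' [s' [Lf us' sn' Lu Nf]]]]] :=
  @NablaX_cocone A O F X LF plt lx (toF b') (toF d) h'.
have [k [[k' [k1 k2]] kg kh]] := rt_same_first rtD Dq (DeltaGX_cone Df).
have [j [[j' [j1 j2]] jg jh]] := left_same_last ltN Nq (NablaGX_cocone Nf).
split=> [al be sq | be al sq].
  have [y Ty] := Theta_exl al; have [_ yE] := adE _ _ _ _ Ty.
  have [|ga [e1 e2]] := glue_cone_b Rf su qs Lf us' Lu (be := j' ∘ be) Ty.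
    by rewrite -compA sq jh -!compA (compA j') j1 comp1m.
  exists (ga ∘ k); split.
    by rewrite -compA kg e1 -jg -compA (compA j) j2 comp1m.
  by rewrite compA e2 kh compA -yE.
have [z Tz] := Theta_exr al; have [zE _] := adE _ _ _ _ Tz.
have [|ga [e1 e2]] := glue_cone_c Rf su Ru Lf us' sn' (be := be ∘ k') Tz.
  by rewrite compA sq kh -!compA k2 compm1.
exists (j ∘ ga); split.
  by rewrite compA jg e1 -kg -compA (compA k') k1 comp1m.
by rewrite -[LHS]compA e2 jh zE !compA.
Qed.

End PrePartial.

Theorem theorem5p7 (A : addcat) (Omega Sigma : addfun A A) (F C X : addsub A)
    (LF : lseq Omega -> Prop) (RC : rseq Sigma -> Prop)
    (P : pre_partial_triangulated F C X LF RC) :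
  @pre_triangulated (stable (subcatI C F) X)
    (GX (pp_right P) (pp_rfix P) (pp_pre P))
    (HX (pp_left P) (pp_lfix P) (pp_cov P))
    (@DeltaGX A Sigma C X RC (pp_right P) (pp_rfix P) (subcatI C F) (pp_pre P))
    (@NablaGX A Omega F X LF (pp_left P) (pp_lfix P) (subcatI C F) (pp_cov P)).
Proof.
split.
- exact: DeltaGX_right_triangulated (@pp_rstab _ _ _ _ _ _ _ _ P).
- exact: NablaGX_left_triangulated (@pp_lstab _ _ _ _ _ _ _ _ P).
- exact: pre_triangulated_glue.
Qed.
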